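(* Let $\mathbf k$ be a field, let $I$ be a finite set with at least two elements, and let $\mathcal T_I$ be the category of reduced $I$-trees. The category $\mathcal T_I$ is Koszul. That is: for any two objects $t,s$ of $\mathcal T_I$ with $s=t/E$, $E\subset E_t$, $|E|=n$, the homology of the normalized bar complex $N_*(b_s,\mathcal T_I,b_t)$ is concentrated in its top degree $n$, with value $$H_n\big(N_*(b_s,\mathcal T_I,b_t)\big)\cong K_n(b_s,\mathcal T_I,b_t)=\Lambda^{n}(\mathbf k[E]),\qquad H_i\big(N_*(b_s,\mathcal T_I,b_t)\big)=0\ \text{ for } i\neq n .$$ (If there is no $E\subset E_t$ with $s=t/E$, then both $N_*(b_s,\mathcal T_I,b_t)$ and $K_*(b_s,\mathcal T_I,b_t)$ are $0$.)
   Context: A tree is a non-empty connected oriented graph without loops such that each vertex has at least one incoming edge and exactly one outgoing edge. Edges without source are the leaves; exactly one edge (the root edge) has no target; the edges having both a source and a target vertex are the internal edges. $E_t$ is the set of internal edges of $t$, $V_t$ its set of vertices, $\mathrm{In}(v)$ the set of incoming edges (leaves or internal edges) at $v$. A tree is reduced if $|\mathrm{In}(v)|>1$ for all $v$. An $I$-tree is a tree with a bijection between its set of leaves and $I$. Objects of $\mathcal T_I$ are the reduced $I$-trees (up to isomorphism compatible with the leaf labelling). For $E\subset E_t$ (possibly empty), $t/E$ is the tree obtained by contracting the edges of $E$; its internal edges are identified with $E_t\setminus E$. The set $\mathcal T_I(t,s)$ of morphisms is a point if there is $E\subset E_t$ with $s=t/E$ (such $E$ is then unique), and is empty otherwise.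 For $t\in\mathcal T_I$, $b_t$ is the (left and right) $\mathcal T_I$-module, i.e. co- or contravariant functor from $\mathcal T_I$ to complexes, which sends $t$ to $\mathbf k$ and every $s\ne t$ to $0$. For $s=t/E$, $N_n(b_s,\mathcal T_I,b_t)$ is the vector space with basis the sequences $(E_1,\dots,E_n)$ of non-empty pairwise disjoint subsets of $E$ with $E_1\sqcup\dots\sqcup E_n=E$ (it is $\mathbf k$ in degree $0$ if $E=\emptyset$), with differential $$d(E_1,\dots,E_n)=\sum_{i=1}^{n-1}(-1)^i(E_1,\dots,E_i\sqcup E_{i+1},\dots,E_n).$$ It is $0$ if $s$ is not of the form $t/E$. $K_*(b_s,\mathcal T_I,b_t)$ is $\Lambda^{|E|}(\mathbf k[E])$ concentrated in degree $|E|$ if $s=t/E$, where $\mathbf k[E]$ is the vector space spanned by $E$, and $0$ otherwise. *)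

(* Defs.v *)
From HB Require Import structures.
From mathcomp Require Import all_boot all_order perm all_algebra.
From mathcomp Require Import zify.

Set Implicit Arguments.
Unset Strict Implicit.
Unset Printing Implicit Defensive.

Import GRing.Theory.

(* ------------------------------------------------------------------------ *)
(* Reduced I-trees                                                          *)
(* ------------------------------------------------------------------------ *)

(* Every vertex and edge of a tree is kept explicitly. An edge without source
   is a leaf; the bijection between the leaves and I is given by its inverse. *)
Record lgraph (I : finType) := LGraph {
  vertex : finType;
  edge : finType;
  source : edge -> option vertex;
  target : edge -> option vertex;
  label : I -> edge;
  label_inj : injective label;
  label_leaf : forall e, (source e == None) = (e \in codom label)
}.

Section Graphs.
Variable I : finType.
Implicit Type g : lgraph I.

Definition inputs g (v : vertex g) : {set edge g} :=
  [set e | target e == Some v].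

Definition outputs g (v : vertex g) : {set edge g} :=
  [set e | source e == Some v].

Definition incident g (x y : vertex g + edge g) : bool :=
  match x, y with
  | inl v, inr e | inr e, inl v => (source e == Some v) || (target e == Some v)
  | _, _ => false
  end.

Definition connected_graph g : Prop :=
  forall x y : vertex g + edge g, connect (@incident g) x y.

(* Loops are taken in the unoriented sense. A closed walk v, e, v back and
   forth along an edge is a cycle of length 2 of the incidence relation; an
   edge joining a vertex to itself must be excluded separately. *)
Definition loopless g : Prop :=
  (forall (e : edge g) (v : vertex g),
     ~ (source e = Some v /\ target e = Some v)) /\
  (forall c : seq (vertex g + edge g), ucycle (@incident g) c -> size c <= 2).

Record is_tree g : Prop := IsTree {
  tree_nonempty : 0 < #|{: vertex g + edge g}|;
  tree_connected : connected_graph g;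
  tree_loopless : loopless g;
  tree_inputs : forall v : vertex g, 0 < #|inputs v|;
  tree_outputs : forall v : vertex g, #|outputs v| = 1;
  tree_root : #|[set e : edge g | target e == None]| = 1
}.

Definition reduced g : Prop := forall v : vertex g, 1 < #|inputs v|.

Record itree := ITree {
  itree_graph :> lgraph I;
  itree_tree : is_tree itree_graph;
  itree_reduced : reduced itree_graph
}.

Definition internal g (e : edge g) : bool :=
  (source e != None) && (target e != None).

Definition internal_edge g : finType := {e : edge g | internal e}.

Section Contraction.
Variables (g : lgraph I) (E : {set internal_edge g}).

Definition contracted (e : edge g) : bool := e \in [set val x | x in E].

Definition glued : rel (vertex g) := fun v w =>
  [exists e, contracted e &&
     (((source e == Some v) && (target e == Some w)) ||
      ((source e == Some w) && (target e == Some v)))].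

(* A vertex of g/E is a class of the equivalence relation generated by glued,
   represented by its canonical element. *)
Definition contr_vertex : finType :=
  {v : vertex g | v \in fingraph.roots glued}.

Definition contr_edge : finType := {e : edge g | ~~ contracted e}.

Lemma glued_sym : symmetric glued.
Proof. by move=> v w; apply: eq_existsb => e; rewrite orbC. Qed.

Definition contr_proj (v : vertex g) : contr_vertex :=
  Sub (fingraph.root glued v) (roots_root (sym_connect_sym glued_sym) v).

Lemma label_not_contracted i : ~~ contracted (label g i).
Proof.
apply/imsetP => -[[e ie] _ /= defe]; move: ie.
by rewrite /internal -defe label_leaf codom_f.
Qed.

Definition contr_source (e : contr_edge) : option contr_vertex :=
  omap contr_proj (source (val e)).

Definition contr_target (e : contr_edge) : option contr_vertex :=
  omap contr_proj (target (val e)).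

Definition contr_label (i : I) : contr_edge :=
  Sub (label g i) (label_not_contracted i).

Lemma contr_label_inj : injective contr_label.
Proof. by move=> i j /(congr1 val)/= /label_inj. Qed.

Lemma contr_label_leaf e :
  (contr_source e == None) = (e \in codom contr_label).
Proof.
have -> : (contr_source e == None) = (source (val e) == None).
  by rewrite /contr_source; case: (source _).
rewrite label_leaf; apply/codomP/codomP => -[i defe]; exists i.
  exact: val_inj.
by rewrite defe.
Qed.

Definition contract : lgraph I :=
  LGraph contr_target contr_label_inj contr_label_leaf.

End Contraction.

Definition bijb (A B : finType) (f : {ffun A -> B}) : bool :=
  injectiveb f && [forall y, y \in codom f].

Definition lgraph_iso g h : bool :=
  [exists fv : {ffun vertex g -> vertex h},
   exists fe : {ffun edge g -> edge h},
   [&& bijb fv, bijb fe,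
       [forall e, (source (fe e) == omap fv (source e)) &&
                  (target (fe e) == omap fv (target e))] &
       [forall i, fe (label g i) == label h i]]].

(* s = t/E, the objects being trees up to label-preserving isomorphism. *)
Definition is_contraction (s t : itree) (E : {set internal_edge t}) : bool :=
  lgraph_iso s (contract E).

End Graphs.

(* ------------------------------------------------------------------------ *)
(* Linear algebra                                                           *)
(* ------------------------------------------------------------------------ *)

Local Open Scope ring_scope.

Section LinearAlgebra.
Variable k : fieldType.

Definition vect_iso (V W : vectType k) : Prop :=
  exists f : {linear V -> W}, bijective f.

Definition vect_zero (V : vectType k) : Prop := forall x : V, x = 0.

(* The subquotient U / (U :&: W), realised on a complement of U :&: W in U;
   the lemmas below give its projection and its kernel. *)
Definition subquot (V : vectType k) (U W : {vspace V}) : vectType k :=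
  subvs_of (U :\: W)%VS.

Definition subquot_proj (V : vectType k) (U W : {vspace V}) (x : V) :
  subquot U W := Subvs (memv_pi (U :\: W) W x).

Lemma subquot_proj_linear (V : vectType k) (U W : {vspace V}) :
  linear (@subquot_proj V U W).
Proof. by move=> a x y; apply: val_inj; rewrite /= linearP. Qed.

Lemma subquot_proj_surj (V : vectType k) (U W : {vspace V}) (q : subquot U W) :
  exists2 x, x \in U & subquot_proj U W x = q.
Proof.
exists (vsval q); first exact: (subvP (diffvSl U W) _ (subvsP q)).
apply: val_inj => /=; apply: daddv_pi_id (subvsP q); exact: capv_diff.
Qed.

Lemma subquot_proj_ker (V : vectType k) (U W : {vspace V}) (x : V) :
  x \in U -> (subquot_proj U W x == 0) = (x \in W).
Proof.
move=> xU; have xUW : x \in (U + W)%VS by apply: (subvP (addvSl U W)).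
have dec := addv_pi1_pi2 xUW.
rewrite -val_eqE /=; apply/eqP/idP => [x0 | xW].
  by rewrite -dec /addv_pi1 x0 add0r memv_pi2.
by move: dec; rewrite addv_pi2_id // -[RHS]add0r => /addIr.
Qed.

Record complex := Complex {
  chain : nat -> vectType k;
  bdry : forall n, 'Hom(chain n.+1, chain n);
  bdryK : forall n, (bdry n \o bdry n.+1)%VF = 0
}.

Definition cycles (C : complex) (n : nat) : {vspace chain C n} :=
  match n with 0 => fullv | m.+1 => lker (bdry C m) end.

Definition homology (C : complex) (n : nat) : vectType k :=
  subquot (cycles C n) (limg (bdry C n)).

(* k[T], and its standard basis. *)
Definition freev (T : finType) : vectType k := {ffun T -> k^o}.

Definition delta (T : finType) (a : T) : freev T :=
  [ffun b => (b == a)%:R : k^o].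

Lemma freev_sum (T : finType) (x : freev T) :
  x = \sum_a (x a : k) *: delta a.
Proof.
apply/ffunP => b; rewrite sum_ffunE (bigD1 b) //= big1 => [|a ab].
  by rewrite !ffunE eqxx addr0 /GRing.scale /= mulr1.
by rewrite !ffunE eq_sym (negPf ab) scaler0.
Qed.

(* The linear map k[A] -> W extending f : A -> W. *)
Definition free_ext (A : finType) (W : lmodType k) (f : A -> W) (x : freev A) :
  W := \sum_a (x a : k) *: f a.

Lemma free_ext_linear (A : finType) (W : lmodType k) (f : A -> W) :
  linear (free_ext f).
Proof.
move=> a x y; rewrite /free_ext scaler_sumr -big_split /=; apply: eq_bigr => b _.
by rewrite !ffunE scalerDl scalerA.
Qed.

HB.instance Definition _ (A : finType) (W : lmodType k) (f : A -> W) :=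
  GRing.isLinear.Build k (freev A) W *:%R (free_ext f) (free_ext_linear f).

Lemma free_ext_delta (A : finType) (W : lmodType k) (f : A -> W) a :
  free_ext f (delta a) = f a.
Proof.
rewrite /free_ext (bigD1 a) //= big1 => [|b ba].
  by rewrite !ffunE eqxx addr0 scale1r.
by rewrite !ffunE (negPf ba) scale0r.
Qed.

(* ------------------------------------------------------------------------ *)
(* Exterior powers of k[T]                                                  *)
(* ------------------------------------------------------------------------ *)

Section Exterior.
Variables (T : finType) (n : nat).

Implicit Types (v : {ffun 'I_n -> freev T}) (w : {ffun 'I_n -> T}).

(* The n-th tensor power of k[T], which is free on the words of length n. *)
Definition tensor_power : vectType k := freev {ffun 'I_n -> T}.

Definition pure_tensor v : tensor_power :=
  [ffun w : {ffun 'I_n -> T} => \prod_i (v i (w i) : k)].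

Definition swap_word (i j : 'I_n) (w : {ffun 'I_n -> T}) : {ffun 'I_n -> T} :=
  [ffun l => w (tperm i j l)].

Definition alt_relations : {vspace tensor_power} :=
  (<<[seq delta w | w in [set w : {ffun 'I_n -> T} | ~~ injectiveb w]]>> +
   <<[seq (delta p.2 + delta (swap_word p.1.1 p.1.2 p.2))%R |
        p in [set p : 'I_n * 'I_n * {ffun 'I_n -> T} | p.1.1 != p.1.2]]>>)%VS.

Definition exterior_power : vectType k := subquot fullv alt_relations.

Definition wedge v : exterior_power :=
  subquot_proj fullv alt_relations (pure_tensor v).

Definition replace v (i : 'I_n) (x : freev T) : {ffun 'I_n -> freev T} :=
  [ffun j => if j == i then x else v j].

Definition multilinear (W : lmodType k) (f : {ffun 'I_n -> freev T} -> W) :=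
  forall v i (a : k) x y,
    f (replace v i (a *: x + y)) = a *: f (replace v i x) + f (replace v i y).

Definition alternating (W : lmodType k) (f : {ffun 'I_n -> freev T} -> W) :=
  forall v i j, i != j -> v i = v j -> f v = 0.

Lemma pure_tensor_multilinear : multilinear pure_tensor.
Proof.
move=> v i a x y; apply/ffunP => w; rewrite !ffunE.
rewrite !(bigD1 (P := predT) i) //= !ffunE eqxx.
have E z : \prod_(j | j != i) (replace v i z j (w j) : k) =
           \prod_(j | j != i) (v j (w j) : k).
  by apply: eq_bigr => j ji; rewrite !ffunE (negPf ji).
by rewrite !E !ffunE mulrDl /GRing.scale /= mulrA.
Qed.

Lemma wedge_multilinear : multilinear wedge.
Proof.
move=> v i a x y.
by rewrite /wedge pure_tensor_multilinear subquot_proj_linear.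
Qed.

Definition basis_word (w : {ffun 'I_n -> T}) : {ffun 'I_n -> freev T} :=
  [ffun i => delta (w i)].

Lemma multilinear0 (W : lmodType k) (f : {ffun 'I_n -> freev T} -> W) :
  multilinear f -> (forall w, f (basis_word w) = 0) -> forall v, f v = 0.
Proof.
move=> fm f0 v.
pose basic (v : {ffun 'I_n -> freev T}) i := [exists a, v i == delta a].
have [m] := ubnP #|[set i | ~~ basic v i]|; elim: m v => // m IHm v lt_m.
have [all_b | ] := boolP [forall i, basic v i].
  have pickb i : {a | v i == delta a}.
    by apply: sigW; apply/existsP/(forallP all_b).
  suff -> : v = basis_word [ffun i => sval (pickb i)] by apply: f0.
  by apply/ffunP => i; rewrite !ffunE; apply/eqP/(svalP (pickb i)).
rewrite negb_forall => /existsP[i nbi].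
have lin0 : f (replace v i 0) = 0.
  have := fm v i 1 0 0; rewrite !scale1r addr0 => /eqP.
  by rewrite -subr_eq0 opprD addNKr oppr_eq0 => /eqP.
have sumf (r : seq T) : f (replace v i (\sum_(a <- r) (v i a : k) *: delta a)) =
    \sum_(a <- r) (v i a : k) *: f (replace v i (delta a)).
  by elim: r => [|a r IHr]; rewrite ?big_nil // !big_cons fm IHr.
have -> : v = replace v i (\sum_a (v i a : k) *: delta a).
  by apply/ffunP => j; rewrite !ffunE -freev_sum; case: eqP => [->|].
rewrite sumf big1 // => a _; rewrite IHm ?scaler0 //.
rewrite -ltnS; apply: leq_trans lt_m; rewrite ltnS; apply: proper_card.
apply/properP; split.
  apply/subsetP => j; rewrite !inE; apply: contra => /existsP[b bP].
  apply/existsP; rewrite !ffunE; case: eqP => [_|_]; first by exists a.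
  by exists b.
exists i; rewrite inE // negbK; apply/existsP; exists a.
by rewrite !ffunE eqxx.
Qed.

Lemma pure_tensor_basis w : pure_tensor (basis_word w) = delta w.
Proof.
apply/ffunP => u; rewrite !ffunE.
have [-> | neq] := eqVneq u w.
  by rewrite big1 // => i _; rewrite !ffunE eqxx.
have /existsP[i neqi] : [exists i, u i != w i].
  rewrite -negb_forall; apply: contra neq => /forallP E.
  by apply/eqP/ffunP => i; apply/eqP/E.
by rewrite (bigD1 i) //= !ffunE (negPf neqi) mul0r.
Qed.

Lemma multilinear_expand (W : lmodType k) (f : {ffun 'I_n -> freev T} -> W) :
  multilinear f -> forall v, f v = free_ext (f \o basis_word) (pure_tensor v).
Proof.
move=> fm v; apply/eqP; rewrite -subr_eq0; apply/eqP.
pose F v := f v - free_ext (f \o basis_word) (pure_tensor v).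
rewrite -[LHS]/(F v); apply: multilinear0 => [u i a x y | w]; rewrite /F.
  rewrite fm pure_tensor_multilinear linearP /= scalerBr opprD.
  by rewrite !addrA; congr (_ + _); rewrite -!addrA; congr (_ + _); rewrite addrC.
by rewrite pure_tensor_basis free_ext_delta subrr.
Qed.

Lemma delta_noninj w : ~~ injectiveb w -> delta w \in alt_relations.
Proof.
move=> nw; apply: (subvP (addvSl _ _)); apply: memv_span.
by apply/imageP; exists w; rewrite ?inE.
Qed.

Lemma delta_swap i j w :
  i != j -> delta w + delta (swap_word i j w) \in alt_relations.
Proof.
move=> ij; apply: (subvP (addvSr _ _)); apply: memv_span.
by apply/imageP; exists (i, j, w); rewrite ?inE.
Qed.

Lemma swap_wordK i j : involutive (swap_word i j).
Proof. by move=> w; apply/ffunP => l; rewrite !ffunE tpermK. Qed.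

Lemma wedge_alternating : alternating wedge.
Proof.
move=> v i j ij vij; apply/eqP; rewrite subquot_proj_ker ?memvf //.
rewrite (freev_sum (pure_tensor v)).
pose r (w : {ffun 'I_n -> T}) l := enum_rank (w l) : nat.
rewrite (bigID (fun w : {ffun 'I_n -> T} => w i == w j)) /=; apply: memvD.
  apply: memv_suml => w /eqP wij; apply/memvZ/delta_noninj.
  by apply: contra ij => /injectiveP/(_ _ _ wij)->.
rewrite (bigID (fun w => r w i < r w j)%N) /=.
rewrite [X in _ + X](reindex_inj (inv_inj (swap_wordK i j))) /=.
rewrite [X in _ + X](eq_bigl (fun w : {ffun 'I_n -> T} =>
  (w i != w j) && (r w i < r w j)%N)); last first.
  move=> w; rewrite /r !ffunE tpermL tpermR eq_sym -leqNgt.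
  case: eqVneq => //= neq; rewrite leq_eqVlt; case: eqP => //= /val_inj.
  by move/enum_rank_inj/eqP; rewrite (negPf neq).
rewrite -big_split /=; apply: memv_suml => w _.
suff -> : pure_tensor v (swap_word i j w) = pure_tensor v w.
  by rewrite -scalerDr; apply/memvZ/delta_swap.
rewrite !ffunE (reindex_inj (@perm_inj _ (tperm i j))) /=.
apply: eq_bigr => l _; rewrite !ffunE tpermK.
by congr (fun_of_fin _ _); case: tpermP => // ->.
Qed.

Lemma alternating_swap (W : lmodType k) (f : {ffun 'I_n -> freev T} -> W) :
  multilinear f -> alternating f ->
  forall v i j, i != j -> f v + f [ffun l => v (tperm i j l)] = 0.
Proof.
move=> fm fa v i j ij; pose h x y := f (replace (replace v i x) j y).
have hl x x' y : h (x + x') y = h x y + h x' y.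
  have C z : replace (replace v i z) j y = replace (replace v j y) i z.
    apply/ffunP => l; rewrite !ffunE; case: (eqVneq l i) => // ->.
    by rewrite (negPf ij).
  by rewrite /h !C -[x in x + x']scale1r fm scale1r.
have hr x y y' : h x (y + y') = h x y + h x y'.
  by rewrite /h -[y in y + y']scale1r fm scale1r.
have h0 x : h x x = 0.
  by apply: (fa _ i j ij); rewrite !ffunE (negPf ij) !eqxx.
have := h0 (v i + v j); rewrite hl !hr !h0 add0r addr0 => E.
rewrite -[RHS]E; congr (_ + _); congr (f _); apply/ffunP => l.
  rewrite !ffunE; case: (eqVneq l j) => [-> //|_].
  by case: (eqVneq l i) => [->|].
rewrite !ffunE; case: tpermP => [->|->|/eqP/negPf-> /eqP/negPf->] //.
  by rewrite (negPf ij) eqxx.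
by rewrite eqxx.
Qed.

Lemma exterior_power_universal
    (W : lmodType k) (f : {ffun 'I_n -> freev T} -> W) :
  multilinear f -> alternating f ->
  exists g : {linear exterior_power -> W},
    (forall v, g (wedge v) = f v) /\
    (forall g' : {linear exterior_power -> W},
       (forall v, g' (wedge v) = f v) -> g' =1 g).
Proof.
move=> fm fa; pose G : {linear tensor_power -> W} := free_ext (f \o basis_word).
have Gd w : G (delta w) = f (basis_word w) by apply: free_ext_delta.
have G0 x : x \in alt_relations -> G x = 0.
  have Gspan (X : seq tensor_power) : (forall y, y \in X -> G y = 0) ->
      forall y, y \in <<X>>%VS -> G y = 0.
    move=> X0 y /(coord_span (X := in_tuple X))->; rewrite linear_sum big1 // => i _.
    by rewrite linearZ /= X0 ?scaler0 // mem_nth.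
  case/memv_addP=> y yP [z zP ->]; rewrite linearD /=.
  rewrite (Gspan _ _ _ yP) ?(Gspan _ _ _ zP) ?addr0 //.
    move=> u /imageP[[[i j] w]]; rewrite inE /= => ij ->; rewrite linearD /= !Gd.
    rewrite -[RHS](alternating_swap fm fa (basis_word w) ij); congr (_ + f _).
    by apply/ffunP => l; rewrite !ffunE.
  move=> u /imageP[w]; rewrite inE => nw ->; rewrite Gd.
  have /injectivePn[i [j ij wij]] := nw.
  by apply: (fa _ i j ij); rewrite !ffunE wij.
have lin_of (V : lmodType k) (h : V -> W) :
    linear h -> exists h' : {linear V -> W}, h' =1 h.
  move=> hl; pose hm := GRing.isLinear.Build k V W *:%R h hl.
  pose h' : {linear V -> W} := HB.pack h hm.
  by exists h'.
have gl : linear (fun q : exterior_power => G (vsval q)).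
  by move=> a x y; rewrite linearP.
have [g gG] := lin_of _ _ gl.
have gE x : g (subquot_proj fullv alt_relations x) = G x.
  have xS : x \in (fullv + alt_relations)%VS by rewrite addvC addvf memvf.
  rewrite gG -[x in RHS](addv_pi1_pi2 xS) linearD /= [X in _ = _ + X]G0 ?addr0 //.
  exact: memv_pi2.
exists g; split=> [v | g' g'P q].
  by rewrite /wedge gE; apply/esym/multilinear_expand.
have [x _ <-] := subquot_proj_surj q; rewrite gE (freev_sum x).
pose gp y := g' (subquot_proj fullv alt_relations y).
have gpl : linear gp by move=> a y z; rewrite /gp subquot_proj_linear linearP.
have [h hE] := lin_of _ _ gpl.
rewrite -[LHS]/(gp _) -hE !linear_sum; apply: eq_bigr => w _; rewrite !linearZ /=.
by rewrite Gd -g'P /wedge pure_tensor_basis hE.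
Qed.

End Exterior.

End LinearAlgebra.

(* ------------------------------------------------------------------------ *)
(* The normalized bar complex and the Koszul complex                        *)
(* ------------------------------------------------------------------------ *)

Section Compositions.
Variable X : finType.

Definition ordered_partition (n : nat) (E : {set X})
    (c : {ffun 'I_n -> {set X}}) : bool :=
  [&& [forall i, c i != set0],
      [forall i, forall j, (i != j) ==> [disjoint c i & c j]] &
      \bigcup_i c i == E].

(* (E_0, ..., E_n) |-> (E_0, ..., E_i :|: E_{i+1}, ..., E_n). *)
Definition merge (n : nat) (i : 'I_n) (c : {ffun 'I_n.+1 -> {set X}}) :
  {ffun 'I_n -> {set X}} :=
  [ffun j : 'I_n =>
     if (j < i)%N then c (widen_ord (leqnSn n) j)
     else if j == i then c (widen_ord (leqnSn n) j) :|: c (lift ord0 j)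
     else c (lift ord0 j)].

Lemma in_merge n (i : 'I_n) c (j : 'I_n) x :
  (x \in merge i c j) = [exists l : 'I_n.+1, (unbump i l == j) && (x \in c l)].
Proof.
have S (l : 'I_n.+1) (m : 'I_n) : (l : nat) = m -> widen_ord (leqnSn n) m = l.
  by move=> E; apply: val_inj.
have L (l : 'I_n.+1) (m : 'I_n) : (l : nat) = m.+1 -> lift ord0 m = l.
  by move=> E; apply: val_inj; rewrite /= /bump add1n E.
rewrite ffunE /unbump; apply/idP/existsP.
  case: ltnP => [ji xc | ij].
    by exists (widen_ord (leqnSn n) j); rewrite xc andbT /=; lia.
  case: (eqVneq j i) => [ji | neq].
    rewrite inE => /orP[] xc.
      by exists (widen_ord (leqnSn n) j); rewrite xc andbT /= ji; lia.
    by exists (lift ord0 j); rewrite xc andbT /= /bump ji; lia.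
  move: neq; rewrite -val_eqE /= => neq xc.
  by exists (lift ord0 j); rewrite xc andbT /= /bump; lia.
case=> l /andP[/eqP E xc]; case: ltnP => [ji | ij].
  by rewrite (S l) //; lia.
case: eqVneq => [ji | ]; last first.
  by rewrite -val_eqE /= => neq; rewrite (L l) //; lia.
rewrite inE; have [li | li] := leqP l i.
  by rewrite (S l) ?xc //; have := congr1 val ji => /=; lia.
by rewrite (L l) ?xc ?orbT //; have := congr1 val ji => /=; lia.
Qed.

Lemma merge_partition n (i : 'I_n) E c :
  ordered_partition E c -> ordered_partition E (merge i c).
Proof.
case/and3P=> /forallP ne /forallP dj /eqP cov; apply/and3P; split.
- apply/forallP => j.
  have [l lj] : exists l : 'I_n.+1, unbump i l = j.
    have [ji|ij] := leqP j i; first by exists (widen_ord (leqnSn n) j); rewrite /unbump /=; lia.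
    by exists (lift ord0 j); rewrite /unbump /= /bump; lia.
  have /set0Pn[x xc] := ne l; apply/set0Pn; exists x.
  by rewrite in_merge; apply/existsP; exists l; rewrite lj eqxx.
- apply/forallP => j; apply/forallP => j'; apply/implyP => jj'.
  apply/pred0P => x; apply/negP => /andP[]/=; rewrite !in_merge.
  move=> /existsP[l /andP[/eqP lj xl]] /existsP[l' /andP[/eqP lj' xl']].
  have [ll' | neq] := eqVneq l l'.
    by move: jj'; rewrite -val_eqE /= -lj -lj' ll' eqxx.
  have /pred0P/(_ x) := implyP (forallP (dj l) l') neq.
  by rewrite /= xl xl'.
- apply/eqP; rewrite -cov; apply/setP => x; apply/bigcupP/bigcupP.
    by move=> [j _]; rewrite in_merge => /existsP[l /andP[_ xl]]; exists l.
  move=> [l _ xl]; have ln : (unbump i l < n)%N.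
    by have := ltn_ord l; have := ltn_ord i; rewrite /unbump; lia.
  exists (Ordinal ln) => //; rewrite in_merge; apply/existsP; exists l.
  by rewrite /= eqxx.
Qed.

Lemma merge_merge n (i : 'I_n) (j : 'I_n.+1) (c : {ffun 'I_n.+2 -> {set X}})
    (i' : 'I_n) (j' : 'I_n.+1) :
  (i < j)%N -> (i' : nat) = j.-1 -> (j' : nat) = i ->
  merge i (merge j c) = merge i' (merge j' c).
Proof.
move=> ij Ei Ej; apply/ffunP => m; apply/setP => x; rewrite !in_merge.
have red (a : 'I_n) (b : 'I_n.+1) :
    [exists l : 'I_n.+1, (unbump a l == m) && (x \in merge b c l)] =
    [exists l : 'I_n.+2, (unbump a (unbump b l) == m) && (x \in c l)].
  apply/existsP/existsP => [[l /andP[lm]] | [l /andP[lm xl]]].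
    rewrite in_merge => /existsP[p /andP[/eqP pl xp]].
    by exists p; rewrite pl lm.
  have ln : (unbump b l < n.+1)%N.
    by have := ltn_ord l; have := ltn_ord b; rewrite /unbump; lia.
  exists (Ordinal ln); rewrite lm in_merge; apply/existsP; exists l.
  by rewrite /= eqxx.
rewrite !red; apply: eq_existsb => l; congr (_ && _); congr (_ == _).
rewrite Ei Ej /unbump; lia.
Qed.

End Compositions.

Section Bar.
Variables (k : fieldType) (I : finType) (s t : itree I).

(* A set E with s = t/E is unique when it exists; the basis is empty when there
   is none. *)
Definition bar_cond (n : nat) (c : {ffun 'I_n -> {set internal_edge t}}) :
  bool :=
  [exists E : {set internal_edge t},
     is_contraction s E && ordered_partition E c].

Definition bar_basis (n : nat) : finType :=
  {c : {ffun 'I_n -> {set internal_edge t}} | bar_cond c}.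

Lemma bar_face_subproof n (i : 'I_n) (c : bar_basis n.+1) :
  bar_cond (merge i (val c)).
Proof.
have /existsP[E /andP[sE cE]] := valP c.
by apply/existsP; exists E; rewrite sE merge_partition.
Qed.

Definition bar_face n (i : 'I_n) (c : bar_basis n.+1) : bar_basis n :=
  Sub (merge i (val c)) (bar_face_subproof i c).

Definition bar_chain (n : nat) : vectType k := freev k (bar_basis n).

(* Positions are numbered from 0, whence the shift in the sign. *)
Definition bar_bdry_basis n (c : bar_basis n.+1) : bar_chain n :=
  \sum_(i < n) (-1) ^+ i.+1 *: delta k (bar_face i c).

Definition bar_bdry (n : nat) : 'Hom(bar_chain n.+1, bar_chain n) :=
  linfun (free_ext (@bar_bdry_basis n)).

Lemma bar_bdry_delta n c : bar_bdry n (delta k c) = bar_bdry_basis c.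
Proof. by rewrite lfunE /= free_ext_delta. Qed.

Lemma bar_bdryK n : (bar_bdry n \o bar_bdry n.+1)%VF = 0.
Proof.
apply/lfunP => x; rewrite (freev_sum x) linear_sum big1 ?lfunE // => c _.
rewrite linearZ /= comp_lfunE bar_bdry_delta /bar_bdry_basis linear_sum /=.
under eq_bigr => j _ do rewrite linearZ /= bar_bdry_delta scaler_sumr.
rewrite [X in _ *: X](_ : _ = 0) ?scaler0 //; clear x.
case: n c => [|n] c; first by rewrite big1 // => j _; rewrite big_ord0.
rewrite pair_big /= (bigID (fun p : 'I_n.+2 * 'I_n.+1 => p.2 < p.1)%N) /=.
pose h (p : 'I_n.+2 * 'I_n.+1) : 'I_n.+2 * 'I_n.+1 := (inord p.2, inord p.1.-1).
pose h' (p : 'I_n.+2 * 'I_n.+1) : 'I_n.+2 * 'I_n.+1 := (inord p.2.+1, inord p.1).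
rewrite [X in _ + X](reindex_onto h h') /=; last first.
  case=> j i /=; rewrite -leqNgt => ji; have := ltn_ord i => ilt.
  by congr (_, _); apply: val_inj; rewrite /= !inordK //= ?inordK //; lia.
rewrite [X in _ + X](eq_bigl (fun p : 'I_n.+2 * 'I_n.+1 => p.2 < p.1)%N); last first.
  case=> j i /=; have := ltn_ord i; have := ltn_ord j => jlt ilt.
  rewrite !inordK //=; try lia.
  rewrite -leqNgt xpair_eqE -!val_eqE /= !inordK //=; lia.
rewrite -big_split big1 // => -[j i] /= ij.
have := ltn_ord i; have := ltn_ord j => jlt ilt.
have -> : bar_face (inord j.-1) (bar_face (inord i) c) =
          bar_face i (bar_face j c).
  apply: val_inj; rewrite /=; apply/esym/merge_merge => //.
    by rewrite inordK //; lia.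
  by rewrite inordK //; lia.
rewrite !scalerA -scalerDl -!exprD.
rewrite !inordK; try lia.
have -> : (j.+1 + i.+1 = (i.+1 + j.-1.+1).+1)%N by lia.
by rewrite exprS mulN1r addNr scale0r.
Qed.

Definition bar_complex : complex k := Complex bar_bdryK.

Definition koszul_complex (n : nat) : vectType k :=
  if [pick E | is_contraction s E] is Some E then
    if n == #|E| then exterior_power k {x : internal_edge t | x \in E} n
    else 'rV[k]_0
  else 'rV[k]_0.

End Bar.

(* Main.v *)
Require Import Defs.
From mathcomp Require Import all_boot all_order perm all_algebra.
From HB Require Import structures.
From mathcomp Require Import zify ring.

(** Two facts are needed: the set E with s = t/E is unique, so that the bar
    complex really is the complex of ordered partitions of one set E, and this
    complex has the homology of a sphere, a line in degree #|E|.

    Uniqueness of E. Attach to every edge of a tree its cluster, the set of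
    labels of the leaves above it. In a reduced tree distinct edges have
    distinct clusters ([cluster_inj]), because each vertex has an input that
    contributes leaves of its own. Contraction does not change the clusters of
    the remaining edges ([cluster_contract]) and neither does an isomorphism
    ([lgraph_isoP]). Hence the isomorphism type of t/E determines which edges
    of t survive ([contraction_unique]).

    Homology. A chain is a function z on lists of blocks, and the value of its
    boundary at w is the signed sum of the values of z at the lists obtained by
    splitting one block of w in two. Choose x in E. Over a list w of blocks of
    E minus x lie the partitions of E that arise from w by adding x, either as
    a block of its own in one of the gaps, or inside one of the blocks. They
    form a subdivided interval whose vertices are the gaps. Contracting the
    intervals to the gap at the left end shows that the complex of E is
    homotopy equivalent to the shifted complex of E minus x. In formulas: one
    map is the projection pi taking z to w |-> z([set x] :: w), the other is the
    shuffle product with [set x], and [homotopy_identity] states that a homotopy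
    links the identity to shuffle o pi. By induction on E the homology is a line
    in degree #|E|, spanned by an iterated shuffle product, and vanishes in the
    other degrees ([bdry_list_homology], [bar_homology]).

    The top exterior power of k[E] is a line as well, the determinant being a
    coordinate on it ([exterior_line]), and two lines are isomorphic. *)

Set Implicit Arguments.
Unset Strict Implicit.
Unset Printing Implicit Defensive.

Import GRing.Theory.

(** * Clusters and the uniqueness of the contracted set *)

Local Open Scope nat_scope.

Section Connect.
Variables (T : finType) (r : rel T).

Lemma connect_first x y :
  connect r x y -> x = y \/ exists2 z, r x z & connect r z y.
Proof.
case/connectP=> [[|z p] /=]; first by move=> _ ->; left.
by case/andP=> xz zp ->; right; exists z => //; apply/connectP; exists p.
Qed.

Lemma connect_last x y :
  connect r x y -> x = y \/ exists2 z, connect r x z & r z y.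
Proof.
case/connectP=> p; case/lastP: p => [|p z]; first by move=> _ ->; left.
rewrite rcons_path last_rcons => /andP[xp pz] ->; right.
by exists (last x p) => //; apply/connectP; exists p.
Qed.

Hypothesis r_fun : forall x y z, r x y -> r x z -> y = z.

Lemma connect_fun x y z : connect r x y -> x <> y -> r x z -> connect r z y.
Proof. by case/connect_first=> // -[u xu uy] _ /(r_fun xu) <-. Qed.

(** The iterates of a partial function starting at a point form a chain. *)
Lemma connect_comparable x y z :
  connect r x y -> connect r x z -> connect r y z || connect r z y.
Proof.
case/connectP=> p; elim: p x => [|u p IHp] x /=; first by move=> _ -> ->.
case/andP=> xu up lst; have [xz|/eqP xz] := eqVneq x z.
  subst z y => _; apply/orP; right; apply: connect_trans (connect1 xu) _.
  by apply/connectP; exists p.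
by move/connect_fun/(_ xz xu); apply: IHp up lst.
Qed.

(** A point on a cycle can never leave the cycle, hence never reaches a point
    without successor. *)
Lemma connect_root_antisym x y z : connect r x z -> (forall u, ~~ r z u) ->
  connect r x y -> connect r y x -> x = y.
Proof.
case/connectP=> p + + zu; elim: p x y => [|u p IHp] x y /=.
  by move=> _ <- /connect_first[] // -[v]; rewrite (negPf (zu v)).
case/andP=> xu up lz xy yx; have [//|/eqP neq] := eqVneq x y.
have uy := connect_fun xy neq xu.
have yu := connect_trans yx (connect1 xu).
have uE := IHp _ _ up lz uy yu; subst y.
exact/esym/(IHp _ _ up lz yx (connect1 xu)).
Qed.

End Connect.

Lemma connect_homo (S T : finType) (r : rel S) (r' : rel T) (f : S -> T) :
  (forall x y, r x y -> r' (f x) (f y)) ->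
  forall x y, connect r x y -> connect r' (f x) (f y).
Proof.
move=> rr x y /connectP[p]; elim: p x => [|z p IHp] x /=; first by move=> _ ->.
by case/andP=> xz zp /(IHp _ zp); apply: connect_trans; apply/connect1/rr.
Qed.

Section Clusters.
Variable I : finType.
Implicit Types g h : lgraph I.

Definition parent g : rel (edge g) := fun e f =>
  [exists v, (target e == Some v) && (source f == Some v)].

Definition cluster g (e : edge g) : {set I} :=
  [set i | connect (@parent g) (label g i) e].

Lemma parentP g (e f : edge g) :
  reflect (exists2 v, target e = Some v & source f = Some v) (parent e f).
Proof.
apply: (iffP existsP) => [[v /andP[/eqP ev /eqP fv]]|[v ev fv]]; exists v => //.
by rewrite ev fv eqxx.
Qed.

Section Tree.
Variables (g : lgraph I) (gT : is_tree g).

Lemma source_inj (e f : edge g) v : source e = Some v -> source f = Some v -> e = f.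
Proof.
move=> ev fv; have /eqP/cards1P[u uE] := tree_outputs gT v.
have : e \in outputs v by rewrite inE ev.
have : f \in outputs v by rewrite inE fv.
by rewrite uE !inE => /eqP-> /eqP->.
Qed.

Lemma parent_fun (e f f' : edge g) : parent e f -> parent e f' -> f = f'.
Proof.
case/parentP=> v ev fv /parentP[v']; rewrite ev => -[<-]; exact: source_inj.
Qed.

Lemma exists_output (v : vertex g) : exists e : edge g, source e = Some v.
Proof.
have /eqP/cards1P[u uE] := tree_outputs gT v; exists u; apply/eqP.
by have : u \in outputs v; [rewrite uE set11 | rewrite inE].
Qed.

(** The vertices and edges from which the root edge can be reached along the
    orientation are closed under incidence, since the only edge leaving a vertex
    continues every path through it; connectedness does the rest. *)
Lemma exists_root :
  exists2 r : edge g, forall e, ~~ parent r e & forall e, connect (@parent g) e r.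
Proof.
have /eqP/cards1P[r rE] := tree_root gT.
have r0 : target r = None.
  by apply/eqP; have : r \in [set r]; [rewrite set11 | rewrite -rE inE].
have rN e : ~~ parent r e by apply/negP => /parentP[v]; rewrite r0.
exists r => // e.
pose a (x : vertex g + edge g) := match x with
  | inl v => [exists f, (source f == Some v) && connect (@parent g) f r]
  | inr f => connect (@parent g) f r end.
have inc_sym : symmetric (@incident _ g) by move=> [v|f] [v'|f'].
have acl : closed (@incident _ g) [pred x | a x].
  apply: (intro_closed (sym_connect_sym inc_sym)) => x y; rewrite !inE.
  case: x y => [v|f] [w|f'] //=.
    case/orP=> /eqP vE /existsP[u /andP[/eqP uE ur]].
      by rewrite (source_inj vE uE).
    by apply: connect_trans ur; apply/connect1/parentP; exists v.
  case/orP=> /eqP wE fr; apply/existsP; first by exists f; rewrite wE eqxx.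
  have [u uE] := exists_output w; exists u; rewrite uE eqxx /=.
  apply: (connect_fun parent_fun fr); first by move=> fE; rewrite fE r0 in wE.
  by apply/parentP; exists w.
have := closed_connect acl (tree_connected gT (inr r) (inr e)).
by rewrite !inE /= connect0 => <-.
Qed.

Lemma parent_antisym (e f : edge g) :
  connect (@parent g) e f -> connect (@parent g) f e -> e = f.
Proof.
have [r rN er] := exists_root; exact: (connect_root_antisym parent_fun (er e) rN).
Qed.

Lemma parent_irrefl (e : edge g) : ~~ parent e e.
Proof.
have [r rN er] := exists_root; apply/negP => ee.
have [er'|/eqP er'] := eqVneq e r; first by have := rN e; rewrite -er' ee.
have stable f : connect (@parent g) e f -> f = e.
  case/connectP=> p; elim: p => [|u p IHp] /=; first by [].
  by case/andP=> /(parent_fun ee)<-.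
by apply: er'; rewrite (stable _ (er e)).
Qed.

(** Climbing against the orientation strictly shrinks the set of edges above the
    current one, so it ends at a leaf. *)
Lemma cluster_nonempty (e : edge g) : exists i, i \in cluster e.
Proof.
have [m] := ubnP #|[pred f | connect (@parent g) f e]|.
elim: m e => // m IHm e; rewrite ltnS => em.
case se: (source e) => [v|]; last first.
  move/eqP: se; rewrite label_leaf => /codomP[i ->]; exists i.
  by rewrite inE connect0.
have /card_gt0P[f] := tree_inputs gT v; rewrite inE => /eqP fv.
have fe : parent f e by apply/parentP; exists v.
have [|i] := IHm f; last first.
  by rewrite !inE => fi; exists i; rewrite inE (connect_trans fi (connect1 fe)).
apply: leq_trans em; apply/proper_card/properP; split.
  apply/subsetP => u; rewrite !inE => uf; exact: connect_trans uf (connect1 fe).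
exists e; rewrite !inE ?connect0 //; apply/negP => ef.
by have := parent_irrefl e; rewrite -[X in parent X](parent_antisym (connect1 fe) ef) fe.
Qed.

Hypothesis gR : reduced g.

(** Edges with a common leaf above them are comparable. If e lies strictly above
    e', then e' receives a branch other than the one containing e, and the
    leaves of that branch are above e' but not above e. *)
Lemma cluster_inj : injective (@cluster g).
Proof.
have conn_eq (e e' : edge g) : connect (@parent g) e e' ->
    cluster e = cluster e' -> e = e'.
  move=> /connect_last[] // -[f ef fe'] eqc.
  have /parentP[v fv e'v] := fe'.
  have : f \in inputs v by rewrite inE fv.
  move: (gR v); rewrite (cardsD1 f) => + fin; rewrite fin ltnS.
  case/card_gt0P=> f2; rewrite !inE => /andP[f2f /eqP f2v].
  have f2e' : parent f2 e' by apply/parentP; exists v.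
  have [i] := cluster_nonempty f2; rewrite inE => if2.
  have ie : i \in cluster e.
    by rewrite eqc inE (connect_trans if2 (connect1 f2e')).
  rewrite inE in ie; have i_f := connect_trans ie ef.
  (* Two distinct edges into v, one above the other, would put the edge leaving
     v on an oriented cycle. *)
  have absurd (a b : edge g) : a <> b -> parent a e' -> parent b e' ->
      ~~ connect (@parent g) a b.
    move=> ab ae be; apply/negP => /connect_fun - /(_ parent_fun e' ab ae) eb.
    have := parent_irrefl e'.
    by rewrite -[X in parent X](parent_antisym (connect1 be) eb) be.
  have := connect_comparable parent_fun if2 i_f.
  rewrite (negPf (absurd _ _ _ f2e' fe')) ?(negPf (absurd _ _ _ fe' f2e')) //.
    by move=> ff2; rewrite ff2 eqxx in f2f.
  by move=> ff2; rewrite ff2 eqxx in f2f.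
move=> e e' eqc; have [i ie] := cluster_nonempty e.
have ie' : i \in cluster e' by rewrite -eqc.
rewrite !inE in ie ie'; have := connect_comparable parent_fun ie ie'.
by case/orP=> /conn_eq; [move/(_ eqc) | move/(_ (esym eqc))].
Qed.

End Tree.

Section Contraction.
Variables (g : lgraph I) (E : {set internal_edge g}).
Hypothesis gT : is_tree g.

Let P : rel (edge g) := @parent g.
Let Q : rel (edge (contract E)) := @parent (contract E).

Lemma gluedP v w : reflect
  (exists2 e, contracted E e & (source e = Some v /\ target e = Some w) \/
                              (source e = Some w /\ target e = Some v))
  (glued E v w).
Proof.
apply: (iffP existsP) => [[e /andP[eE /orP[]/andP[/eqP sv /eqP tw]]]|[e eE H]].
- by exists e => //; left.
- by exists e => //; right.
by exists e; rewrite eE /=; case: H => -[-> ->]; rewrite !eqxx ?orbT.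
Qed.

Lemma contr_projP v w :
  reflect (contr_proj E v = contr_proj E w) (connect (glued E) v w).
Proof.
have sym := sym_connect_sym (@glued_sym _ _ E).
rewrite -(root_connect sym); apply: (iffP eqP) => [vw|/(congr1 val)//].
exact: val_inj.
Qed.

Lemma contract_parentP (e f : edge (contract E)) :
  reflect (exists v w, [/\ target (val e) = Some v, source (val f) = Some w &
                           connect (glued E) v w])
          (Q e f).
Proof.
apply: (iffP (parentP _ _)) => [[u]|[v [w [ev fw /contr_projP vw]]]]; last first.
  exists (contr_proj E v); first by rewrite /= /contr_target ev.
  by rewrite /= /contr_source fw /= vw.
rewrite /= /contr_target /contr_source.
case: (target _) => // v -[vu]; case: (source _) => // w -[wu].
by exists v, w; split=> //; apply/contr_projP; rewrite vu wu.
Qed.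

(** A step of the contracted tree jumps between two vertices glued by an
    unoriented path of contracted edges. To lift it one checks that, for an edge
    e' that is not contracted, the set of vertices whose outgoing edge leads down
    to e' is a union of glueing classes. *)
Lemma contract_connect_sub (e f : edge (contract E)) :
  connect Q e f -> connect P (val e) (val f).
Proof.
case/connectP=> p; elim: p e => [|e' p IHp] e /=; first by move=> _ ->.
case/andP=> /contract_parentP[v [w [ev e'w vw]]] /IHp{}IHp /IHp.
apply: connect_trans.
pose a u := [exists o, (source o == Some u) && connect P o (val e')].
have acl : closed (glued E) [pred u | a u].
  apply: (intro_closed (sym_connect_sym (@glued_sym _ _ E))) => x y; rewrite !inE.
  case/gluedP=> c cE cxy /existsP[o /andP[/eqP ox oe']]; apply/existsP.
  case: cxy => -[sc tc].
    have [q qy] := exists_output gT y; exists q; rewrite qy eqxx /=.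
    move: ox oe' => /(source_inj gT sc) <- ce'.
    apply: (connect_fun (parent_fun gT) ce').
      by move=> cee'; have := valP e'; rewrite /= -cee' cE.
    by apply/parentP; exists y.
  exists c; rewrite sc eqxx; apply: connect_trans oe'.
  by apply/connect1/parentP; exists x.
have /existsP[o /andP[/eqP ov]] : v \in [pred u | a u].
  rewrite (closed_connect acl vw) inE; apply/existsP; exists (val e').
  by rewrite e'w eqxx connect0.
by apply: connect_trans; apply/connect1/parentP; exists v.
Qed.

(** Along a path of the original tree, remember the last edge that is not
    contracted: all vertices met since then are glued to its target. *)
Lemma connect_contract (e f : edge (contract E)) :
  connect P (val e) (val f) -> connect Q e f.
Proof.
have claim p : forall (h : edge g) (e : edge (contract E)) v w,
    path P h p -> last h p = val f -> target (val e) = Some v ->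
    source h = Some w -> connect (glued E) v w -> connect Q e f.
  elim: p => [|h' p IHp] h e' v w /=.
    move=> _ hf ev hw vw; apply/connect1/contract_parentP.
    by exists v, w; rewrite -(hf : h = val f).
  case/andP=> /parentP[u hu h'u] pth lst ev hw vw.
  have [hE|hE] := boolP (contracted E h).
    apply: (IHp h' e' v u) => //; apply: connect_trans vw _; apply/connect1/gluedP.
    by exists h => //; left.
  pose hh : edge (contract E) := Sub h hE.
  apply: (@connect_trans _ _ hh); last exact: (IHp h' hh u u).
  by apply/connect1/contract_parentP; exists v, w.
case/connectP=> -[|h p] /=; first by move=> _ /val_inj->.
by case/andP=> /parentP[v ev hv] pth lst; apply: (claim p h e v v).
Qed.

Lemma cluster_contract (e : edge (contract E)) : cluster e = cluster (val e).
Proof.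
apply/setP=> i; rewrite !inE.
apply/idP/idP => [|ie]; first exact: (@contract_connect_sub (label _ i)).
exact: (@connect_contract (label (contract E) i) e ie).
Qed.

End Contraction.

Lemma lgraph_isoP g h : lgraph_iso g h ->
  exists2 f : edge g -> edge h, bijective f & forall e, cluster (f e) = cluster e.
Proof.
case/existsP=> fv /existsP[fe /and4P[/andP[/injectiveP fvI _]]].
case/andP=> /injectiveP feI /forallP feS /forallP comm /forallP lab.
have feB : bijective fe.
  apply: inj_card_bij => //; rewrite -(card_codom feI).
  by apply/subset_leq_card/subsetP.
exists fe => // e; have [ge feK geK] := feB.
have par_e x y : parent x y = parent (fe x) (fe y).
  have /andP[_ /eqP tx] := comm x; have /andP[/eqP sy _] := comm y.
  apply/parentP/parentP => -[v]; rewrite ?tx ?sy.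
    by move=> -> ->; exists (fv v).
  case: (target x) => // u -[<-]; case: (source y) => // w -[/fvI->].
  by exists u.
apply/setP=> i; rewrite !inE -(eqP (lab i)); apply/idP/idP.
  have ge_par x y : parent x y -> parent (ge x) (ge y) by rewrite par_e !geK.
  by move/(connect_homo ge_par); rewrite !feK.
by apply: connect_homo => x y; rewrite par_e.
Qed.

Lemma contraction_unique (s t : itree I) (E F : {set internal_edge t}) :
  is_contraction s E -> is_contraction s F -> E = F.
Proof.
have tT := itree_tree t; have tR := @itree_reduced _ t.
have sub (A B : {set internal_edge t}) : is_contraction s A ->
    is_contraction s B -> A \subset B.
  move=> /lgraph_isoP[f _ fC] /lgraph_isoP[g [g' _ g'K] gC].
  apply/subsetP => x xA; apply: contraLR (xA) => xB.
  have xB' : ~~ contracted B (val x).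
    by apply: contra xB => /imsetP[y yB /val_inj->].
  pose y : edge (contract B) := Sub (val x) xB'.
  have : cluster (val (f (g' y))) = cluster (val x).
    rewrite -cluster_contract // fC -gC g'K cluster_contract //.
  move/(cluster_inj tT tR) => eqx.
  have := valP (f (g' y)); rewrite /= eqx; apply: contra => xA'.
  by apply/imsetP; exists x.
by move=> sE sF; apply/eqP; rewrite eqEsubset !sub.
Qed.

End Clusters.

Local Open Scope ring_scope.

(** * The complex of ordered partitions on lists of blocks *)

Section Lists.
Variables (R : comNzRingType) (X : finType).
Implicit Types (a b E : {set X}) (w v : seq {set X}) (x : X).
Implicit Types (f g y z : seq {set X} -> R).

(** Chains are arbitrary functions on lists, compared pointwise, so that
    compatibility with pointwise equality is part of linearity here. *)
Definition linear_op (T : (seq {set X} -> R) -> seq {set X} -> R) :=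
  (forall f g w, f =1 g -> T f w = T g w) /\
  (forall c f g w, T (fun v => c * f v + g v) w = c * T f w + T g w).

Lemma linear_op0 T w : linear_op T -> T (fun=> 0) w = 0.
Proof.
move=> [Te Tl]; have := Tl 1 (fun=> 0) (fun=> 0) w.
rewrite (Te _ (fun=> 0)) => [|v]; last by rewrite mulr0 addr0.
by rewrite mul1r => /(congr1 (fun r => r - T (fun=> 0) w)); rewrite addrK subrr.
Qed.

Lemma linear_opD T f g w :
  linear_op T -> T (fun v => f v + g v) w = T f w + T g w.
Proof.
move=> [Te Tl]; rewrite -[T f w]mul1r -Tl; apply: Te => v.
by rewrite mul1r.
Qed.

Lemma linear_opN T f w : linear_op T -> T (fun v => - f v) w = - T f w.
Proof.
move=> Tlin; have [Te Tl] := Tlin.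
rewrite -[RHS]addr0 -[X in _ = _ + X](linear_op0 w Tlin) -mulN1r -Tl.
by apply: Te => v; rewrite mulN1r addr0.
Qed.

Lemma linear_opB T f g w :
  linear_op T -> T (fun v => f v - g v) w = T f w - T g w.
Proof. by move=> Tlin; rewrite linear_opD // linear_opN. Qed.

Lemma linear_op_sum T (J : Type) (r : seq J) (P : pred J) F w : linear_op T ->
  T (fun v => \sum_(j <- r | P j) F j v) w = \sum_(j <- r | P j) T (F j) w.
Proof.
move=> Tlin; have [Te Tl] := Tlin.
elim: r => [|j r IHr].
  rewrite big_nil; apply: etrans (linear_op0 w Tlin).
  by apply: Te => v; rewrite big_nil.
rewrite big_cons -IHr; case Pj: (P j); last first.
  by apply: Te => v; rewrite big_cons Pj.
by rewrite -linear_opD //; apply: Te => v; rewrite big_cons Pj.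
Qed.

Definition proper_part a b := (b != set0) && (b \proper a).

Fixpoint blocks E w : bool :=
  if w is a :: w' then [&& a != set0, a \subset E & blocks (E :\: a) w']
  else E == set0.

(** In terms of coefficients the bar differential is the transpose of merging:
    the coefficient at w collects those of all the lists that merge to w. The
    recursion on w makes the sign alternate with the position of the block that
    is split. *)
Fixpoint bdry_list z w : R :=
  if w is a :: w' then
    - \sum_(b | proper_part a b) z [:: b, a :\: b & w']
    - bdry_list (fun v => z (a :: v)) w'
  else 0.

(** The shuffle product of y with the one-block list [:: [set x]]: the coefficient
    at w is, up to sign, that of y at w with the block [set x] removed. *)
Fixpoint shuffle x y w : R :=
  if w is a :: w' then
    if a == [set x] then y w' else - shuffle x (fun v => y (a :: v)) w'
  else 0.

(** The contraction of the interval of all insertions of x to its left end: the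
    coefficient at a list with [set x] as a block collects those of the lists in
    which x is moved from there into one of the blocks on its left. *)
Fixpoint homotopy x z w : R :=
  if w is a :: w' then
    if a == [set x] then 0 else
    - shuffle x (fun v => z (x |: a :: v)) w'
    - homotopy x (fun v => z (a :: v)) w'
  else 0.

Lemma bdry_list_linear : linear_op bdry_list.
Proof.
split=> [f g w|c f g w].
  elim: w f g => //= a w IHw f g fg; congr (- _ - _); last exact: IHw.
  by apply: eq_bigr.
elim: w f g => /= [|a w IHw] f g; first by ring.
by rewrite IHw big_split -mulr_sumr /=; ring.
Qed.

Lemma shuffle_linear x : linear_op (shuffle x).
Proof.
split=> [f g w|c f g w].
  elim: w f g => //= a w IHw f g fg; case: ifP => // _; congr (- _); exact: IHw.
elim: w f g => /= [|a w IHw] f g; first by ring.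
by case: ifP => // _; rewrite IHw; ring.
Qed.

Lemma homotopy_linear x : linear_op (homotopy x).
Proof.
split=> [f g w|c f g w].
  elim: w f g => //= a w IHw f g fg; case: ifP => // _; congr (- _ - _).
    by apply: (shuffle_linear x).1 => v.
  exact: IHw.
elim: w f g => /= [|a w IHw] f g; first by ring.
case: ifP => // _; first by ring.
by rewrite IHw (shuffle_linear x).2; ring.
Qed.

Lemma blocks_split E a b w : proper_part a b ->
  blocks E (a :: w) -> blocks E [:: b, a :\: b & w].
Proof.
move=> /andP[b0 /properP[ba [c ca cb]]] /= /and3P[a0 aE wE].
rewrite b0 (subset_trans ba aE) setSD //=.
have -> : (E :\: b) :\: (a :\: b) = E :\: a.
  apply/setP=> u; rewrite !inE; have := subsetP ba u.
  by case: (u \in a) (u \in b) => [] [] //= /(_ isT).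
rewrite wE andbT; apply/set0Pn; exists c; by rewrite inE cb.
Qed.

(** Locality: on partitions of E the operators only read the values of a chain at
    partitions of E, or of E minus x for the shuffle product, with the expected
    number of blocks. So chains need no condition on their support. *)
Lemma eq_bdry_list E f g w : blocks E w ->
  (forall v, blocks E v -> size v = (size w).+1 -> f v = g v) ->
  bdry_list f w = bdry_list g w.
Proof.
elim: w E f g => //= a w IHw E f g wE fg; congr (- _ - _).
  apply: eq_bigr => b ab; apply: fg => //; exact: blocks_split ab wE.
case/and3P: wE => a0 aE wE; apply: IHw wE _ => v vE sv.
by apply: fg; rewrite /= ?a0 ?aE ?sv.
Qed.

Lemma bdry_list0 E f w : blocks E w ->
  (forall v, blocks E v -> size v = (size w).+1 -> f v = 0) ->
  bdry_list f w = 0.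
Proof.
by move=> wE /(eq_bdry_list wE)->; apply: linear_op0 bdry_list_linear.
Qed.

Lemma shuffle_notin E x y w : x \notin E -> blocks E w -> shuffle x y w = 0.
Proof.
elim: w E y => //= a w IHw E y xE /and3P[a0 aE wE].
case: eqP => [ax|_]; first by case/negP: xE; rewrite -sub1set -ax.
by rewrite (IHw _ _ _ wE) ?oppr0 // inE (negPf xE) andbF.
Qed.

Lemma homotopy_notin E x z w : x \notin E -> blocks E w -> homotopy x z w = 0.
Proof.
elim: w E z => //= a w IHw E z xE /and3P[a0 aE wE]; case: ifP => // _.
have xEa : x \notin E :\: a by rewrite inE (negPf xE) andbF.
by rewrite (IHw _ _ _ wE) // (shuffle_notin _ xEa wE) !oppr0 addr0.
Qed.

Lemma setDDC E a b : (E :\: a) :\: b = (E :\: b) :\: a.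
Proof. by rewrite !setDDl setUC. Qed.

Lemma eq_shuffle E x f g w : x \in E -> blocks E w ->
  (forall v, blocks (E :\ x) v -> (size v).+1 = size w -> f v = g v) ->
  shuffle x f w = shuffle x g w.
Proof.
elim: w E f g => //= a w IHw E f g xE /and3P[a0 aE wE] fg.
case: eqP => [ax|/eqP ax]; first by rewrite ax in wE; apply: fg.
have [xa|xa] := boolP (x \in a).
  by rewrite !(shuffle_notin _ _ wE) // inE xa.
congr (- _); apply: IHw wE _ => [|v vE sv]; first by rewrite inE xa.
apply: fg; rewrite /= ?sv // a0 subsetD1 aE xa /=.
by rewrite setDDC.
Qed.

Lemma shuffle0 E x f w : x \in E -> blocks E w ->
  (forall v, blocks (E :\ x) v -> (size v).+1 = size w -> f v = 0) ->
  shuffle x f w = 0.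
Proof.
by move=> xE wE /(eq_shuffle xE wE)->; apply: linear_op0 (shuffle_linear x).
Qed.

Lemma homotopy0 E x f w : x \in E -> blocks E w ->
  (forall v, blocks E v -> (size v).+1 = size w -> f v = 0) ->
  homotopy x f w = 0.
Proof.
elim: w E f => //= a w IHw E f xE /and3P[a0 aE wE] f0; case: ifP => // _.
have [xa|xa] := boolP (x \in a).
  have xEa : x \notin E :\: a by rewrite inE xa.
  by rewrite (homotopy_notin _ xEa wE) (shuffle_notin _ xEa wE) !oppr0 addr0.
have xEa : x \in E :\: a by rewrite inE xa.
rewrite (shuffle0 xEa wE) ?(IHw _ _ xEa wE) ?oppr0 ?addr0 // => v vE sv; apply: f0.
- by rewrite /= a0 aE.
- by rewrite /= sv.
- rewrite /= subUset sub1set xE aE setUC -setDDl vE !andbT.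
  by apply/set0Pn; exists x; rewrite !inE eqxx orbT.
- by rewrite /= sv.
Qed.

(** A splitting of [x |: a] either splits off [set x] on one side, or comes from a
    splitting of a by adding x to one of the two parts. *)
Lemma sum_parts_setU1 a x (F : {set X} -> {set X} -> R) :
  x \notin a -> a != set0 ->
  \sum_(b | proper_part (x |: a) b) F b ((x |: a) :\: b) =
  F [set x] a + F a [set x] +
  \sum_(b | proper_part a b) (F (x |: b) (a :\: b) + F b (x |: (a :\: b))).
Proof.
move=> xa a0; rewrite big_split (bigID (fun b : {set X} => x \in b)) /=.
have xaD : (x |: a) :\: [set x] = a by rewrite setU1K.
have Da : (x |: a) :\: a = [set x].
  apply/setP=> u; rewrite !inE; case: eqVneq => [->|_]; first by rewrite xa.
  by case: (u \in a).
have sub1 : [set x] \proper x |: a.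
  have [u ua] := set0Pn _ a0; apply/properP; split; first exact: subsetUl.
  by exists u; rewrite !inE ?ua ?orbT //; apply: contraNneq xa => <-.
have suba : a \proper x |: a.
  apply/properP; split; first exact: subsetUr.
  by exists x; rewrite ?setU11.
rewrite (bigD1 [set x]) /=; last first.
  by rewrite /proper_part sub1 inE eqxx -card_gt0 cards1.
rewrite [X in _ + X](bigD1 a) /=; last by rewrite /proper_part a0 suba.
rewrite xaD Da -!addrA; congr (_ + _).
rewrite addrCA; congr (_ + _); congr (_ + _).
  rewrite (reindex_onto (fun b => x |: b) (fun b => b :\ x)) /=; last first.
    by move=> b /andP[/andP[_ xb] _]; rewrite setD1K.
  apply: eq_big => [b|b /andP[_ /eqP xb]]; last first.
    have xnb : x \notin b by rewrite -xb !inE eqxx.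
    congr (F _ _); apply/setP=> u; rewrite !inE.
    by case: eqVneq => //= ->; rewrite (negPf xa) andbF.
  apply/idP/idP.
    move=> /andP[/andP[/andP[/andP[_ /properP[ba [c ca cb]]] _] bx] /eqP xb].
    have xnb : x \notin b by rewrite -xb !inE eqxx.
    apply/andP; split; first by apply: contraNneq bx => ->; rewrite setU0.
    apply/properP; split.
      apply/subsetP => u ub; have := subsetP ba u; rewrite !inE ub orbT => /(_ isT).
      by case: eqVneq ub => //= ->; rewrite (negPf xnb).
    move: ca cb; rewrite !inE negb_or; case: eqVneq => //= _ ca cb.
    by exists c.
  move=> /andP[b0 /properP[ba [c ca cb]]].
  have xnb : x \notin b by apply: contra xa; apply: (subsetP ba).
  rewrite setU11 setU1K ?eqxx // !andbT; apply/andP; split.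
    apply/andP; split; first by apply/set0Pn; exists x; rewrite setU11.
    apply/properP; split; first exact: setUS.
    exists c; first by rewrite inE ca orbT.
    by rewrite !inE (negPf cb) orbF; apply: contraNneq xa => <-.
  have [u ub] := set0Pn _ b0; apply: contraNneq xnb => /setP/(_ u).
  by rewrite !inE ub orbT => /esym/eqP<-.
apply: eq_big => [b|b /andP[/andP[/andP[_ ba] xnb] _]]; last first.
  congr (F _ _); apply/setP=> u; rewrite !inE.
  by case: eqVneq => //= ->; rewrite (negPf xnb).
apply/idP/idP.
  move=> /andP[/andP[/andP[b0 /proper_sub ba] xnb] neq].
  rewrite /proper_part b0 properEneq neq; apply/subsetP => u ub.
  have := subsetP ba u ub; rewrite !inE.
  by case: eqVneq ub => //= ->; rewrite (negPf xnb).
move=> /andP[b0 ba]; have xnb : x \notin b.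
  by apply: contra xa; apply/subsetP/proper_sub.
by rewrite /proper_part b0 (proper_trans ba suba) xnb (proper_neq ba).
Qed.

Lemma proper_part_set1 x b : proper_part [set x] b = false.
Proof.
apply/andP=> -[b0 /proper_card]; rewrite cards1 ltnS leqn0 cards_eq0.
by rewrite (negPf b0).
Qed.

Lemma neq_set1 b x : x \notin b -> (b == [set x]) = false.
Proof. by move=> xb; apply: contraNF xb => /eqP->; rewrite set11. Qed.

Lemma setU1_neq_set1 b x : x \notin b -> b != set0 -> (x |: b == [set x]) = false.
Proof.
move=> xb /set0Pn[u ub]; apply: contraNF xb => /eqP/setP/(_ u).
by rewrite !inE ub orbT => /esym/eqP<-.
Qed.

Lemma proper_part_compl a b : proper_part a b -> a :\: b != set0.
Proof.
by case/andP=> _ /properP[_ [c ca cb]]; apply/set0Pn; exists c; rewrite inE cb.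
Qed.

(** Only the two splittings that isolate x contribute, with opposite signs. *)
Lemma sum_parts_shuffle x y E a w : x \in a -> a != [set x] ->
  x \notin E -> blocks E w ->
  \sum_(b | proper_part a b) shuffle x y [:: b, a :\: b & w] = 0.
Proof.
move=> xa ax xE wE; have R0 f := @shuffle_notin E x f w xE wE.
have xa0 : x \notin a :\ x by rewrite !inE eqxx.
have a0 : a :\ x != set0.
  by apply: contraNneq ax => a0; rewrite -(setD1K xa) a0 setU0.
rewrite -(setD1K xa).
rewrite (sum_parts_setU1 (fun b c => shuffle x y [:: b, c & w]) xa0 a0) /=.
rewrite eqxx (neq_set1 xa0) subrr add0r big1 // => b bP.
have xb : x \notin b.
  by apply: contra xa0; apply/subsetP/proper_sub; case/andP: bP.
have xc : x \notin (a :\ x) :\: b by rewrite !inE eqxx andbF.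
rewrite (neq_set1 xb) (neq_set1 xc) (setU1_neq_set1 xb); last by case/andP: bP.
by rewrite (setU1_neq_set1 xc (proper_part_compl bP)) !R0 !oppr0 addr0.
Qed.

(** The shuffle product is a chain map of degree one: the splittings of a block
    into x and a rest cancel in pairs, those of the other blocks commute with the
    insertion of [set x]. *)
Lemma bdry_shuffle E x y w : x \in E -> blocks E w ->
  bdry_list (shuffle x y) w = - shuffle x (bdry_list y) w.
Proof.
have bdryN f v := linear_opN f v bdry_list_linear.
have shuffleN f v := linear_opN f v (shuffle_linear x).
have shuffleB f g v := linear_opB f g v (shuffle_linear x).
elim: w E y => [|a w IHw] E y xE; first by rewrite /= oppr0.
move=> awE; have /and3P[a0 aE wE] := awE.
have [ax|ax] := eqVneq a [set x].
  rewrite ax /= eqxx big_pred0 => [|b]; last exact: proper_part_set1.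
  by rewrite oppr0 sub0r.
have DE : bdry_list (fun v => shuffle x y (a :: v)) w =
    - bdry_list (shuffle x (fun v => y (a :: v))) w.
  by rewrite -bdryN; apply: bdry_list_linear.1 => v; rewrite /= (negPf ax).
have [xa|xa] := boolP (x \in a).
  have xEa : x \notin E :\: a by rewrite inE xa.
  rewrite [RHS]/= (negPf ax) (shuffle_notin _ xEa wE) [LHS]/=.
  rewrite [X in _ - X]DE (sum_parts_shuffle _ xa ax xEa wE).
  rewrite (bdry_list0 wE) ?subrr ?oppr0 ?addr0 // => v vE _.
  exact: shuffle_notin xEa vE.
have xEa : x \in E :\: a by rewrite inE xa.
have -> : bdry_list (shuffle x y) (a :: w) =
   - \sum_(b | proper_part a b) shuffle x y [:: b, a :\: b & w]
   - bdry_list (fun v => shuffle x y (a :: v)) w by [].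
rewrite DE (IHw _ _ xEa wE) [in RHS]/= (negPf ax) !opprK shuffleB shuffleN.
rewrite (linear_op_sum _ _ _ _ (shuffle_linear x)); congr (- _ + _).
apply: eq_bigr => b bP.
have xb : x \notin b.
  by apply: contra xa; apply/subsetP/proper_sub; case/andP: bP.
have xc : x \notin a :\: b by rewrite inE (negPf xa) andbF.
by rewrite /= (neq_set1 xb) (neq_set1 xc) opprK.
Qed.

(** Of the two splittings that isolate x, the homotopy only sees the one putting
    [set x] on the right, from where x is moved back to the left. *)
Lemma sum_parts_homotopy x z E a w : x \in a -> a != [set x] ->
  x \notin E -> blocks E w ->
  \sum_(b | proper_part a b) homotopy x z [:: b, a :\: b & w] = - z (a :: w).
Proof.
move=> xa ax xE wE; have R0 f := @shuffle_notin E x f w xE wE.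
have H0 f := @homotopy_notin E x f w xE wE.
have xa0 : x \notin a :\ x by rewrite !inE eqxx.
have a0 : a :\ x != set0.
  by apply: contraNneq ax => a0; rewrite -(setD1K xa) a0 setU0.
rewrite -[in LHS](setD1K xa).
rewrite (sum_parts_setU1 (fun b c => homotopy x z [:: b, c & w]) xa0 a0) /=.
rewrite eqxx (neq_set1 xa0) (setD1K xa) subr0 add0r big1 ?addr0 // => b bP.
have xb : x \notin b.
  by apply: contra xa0; apply/subsetP/proper_sub; case/andP: bP.
have xc : x \notin (a :\ x) :\: b by rewrite !inE eqxx andbF.
rewrite (neq_set1 xb) (neq_set1 xc) (setU1_neq_set1 xb); last by case/andP: bP.
by rewrite (setU1_neq_set1 xc (proper_part_compl bP)) !(R0, H0) !(oppr0, addr0).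
Qed.

(** On the interval of insertions of x this is the telescoping sum between a gap
    and the left end. The terms that split blocks free of x cancel because the
    homotopy commutes with them up to sign. *)
Lemma homotopy_identity E x z w : x \in E -> blocks E w ->
  bdry_list (homotopy x z) w + homotopy x (bdry_list z) w =
  z w - shuffle x (fun v => z ([set x] :: v)) w.
Proof.
have bdryN f v := linear_opN f v bdry_list_linear.
have bdryB f g v := linear_opB f g v bdry_list_linear.
have shuffleN f v := linear_opN f v (shuffle_linear x).
have shuffleB f g v := linear_opB f g v (shuffle_linear x).
have homotopyN f v := linear_opN f v (homotopy_linear x).
have homotopyB f g v := linear_opB f g v (homotopy_linear x).
elim: w E z => [|a w IHw] E z xE.
  by rewrite /= => /eqP E0; rewrite E0 inE in xE.
move=> awE; have /and3P[a0 aE wE] := awE.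
have [ax|ax] := eqVneq a [set x].
  rewrite ax /= eqxx big_pred0 => [|b]; last exact: proper_part_set1.
  by rewrite (linear_op0 _ bdry_list_linear) subrr !(oppr0, addr0).
have HE y v : homotopy x y (a :: v) =
    - shuffle x (fun u => y (x |: a :: u)) v - homotopy x (fun u => y (a :: u)) v.
  by rewrite /= (negPf ax).
have DE y v : bdry_list y (a :: v) =
   - \sum_(b | proper_part a b) y [:: b, a :\: b & v]
   - bdry_list (fun u => y (a :: u)) v by [].
have RE : shuffle x (fun v => z ([set x] :: v)) (a :: w) =
    - shuffle x (fun v => z [:: [set x], a & v]) w.
  by rewrite /= (negPf ax).
rewrite RE opprK.
have [xa|xa] := boolP (x \in a).
  (* The remaining blocks do not contain x, and only the splittings of a count. *)
  have xEa : x \notin E :\: a by rewrite inE xa.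
  have R0 f v := @shuffle_notin _ x f v xEa.
  have H0 f v := @homotopy_notin _ x f v xEa.
  rewrite DE (sum_parts_homotopy _ xa ax xEa wE) (bdry_list0 wE).
    by rewrite HE !(R0 _ _ wE) (H0 _ _ wE) !(opprK, oppr0, addr0).
  by move=> v vE _; rewrite HE (R0 _ _ vE) (H0 _ _ vE) oppr0 addr0.
have xEa : x \in E :\: a by rewrite inE xa.
have D_E : bdry_list (fun v => homotopy x z (a :: v)) w =
    shuffle x (bdry_list (fun v => z (x |: a :: v))) w
    - bdry_list (homotopy x (fun v => z (a :: v))) w.
  by rewrite (bdry_list_linear.1 _ _ _ (HE z)) bdryB bdryN (bdry_shuffle _ xEa wE) opprK.
have IH := IHw _ (fun v => z (a :: v)) xEa wE.
rewrite [X in X + _]DE D_E [X in _ + X]HE.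
have -> : shuffle x (fun u => bdry_list z (x |: a :: u)) w =
    - (shuffle x (fun v => z [:: [set x], a & v]) w
       + shuffle x (fun v => z [:: a, [set x] & v]) w
       + \sum_(b | proper_part a b)
            (shuffle x (fun v => z [:: x |: b, a :\: b & v]) w
             + shuffle x (fun v => z [:: b, x |: (a :\: b) & v]) w))
    - shuffle x (bdry_list (fun v => z (x |: a :: v))) w.
  rewrite /= shuffleB shuffleN (linear_op_sum _ _ _ _ (shuffle_linear x)).
  by rewrite (sum_parts_setU1 (fun b c => shuffle x (fun v => z [:: b, c & v]) w)).
have -> : homotopy x (fun u => bdry_list z (a :: u)) w =
    - \sum_(b | proper_part a b) homotopy x (fun v => z [:: b, a :\: b & v]) w
    - homotopy x (bdry_list (fun v => z (a :: v))) w.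
  by rewrite /= homotopyB homotopyN (linear_op_sum _ _ _ _ (homotopy_linear x)).
have -> : \sum_(b | proper_part a b) homotopy x z [:: b, a :\: b & w] =
    \sum_(b | proper_part a b)
            (shuffle x (fun v => z [:: x |: b, a :\: b & v]) w
             + shuffle x (fun v => z [:: b, x |: (a :\: b) & v]) w)
   + \sum_(b | proper_part a b) homotopy x (fun v => z [:: b, a :\: b & v]) w.
  rewrite -big_split /=; apply: eq_bigr => b bP.
  have xb : x \notin b.
    by apply: contra xa; apply/subsetP/proper_sub; case/andP: bP.
  have xc : x \notin a :\: b by rewrite inE (negPf xa) andbF.
  by rewrite /= (neq_set1 xb) (neq_set1 xc); ring.
rewrite -[z (a :: w)](subrK (shuffle x (fun v => z [:: a, [set x] & v]) w)) -IH.
ring.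
Qed.

(** The iterated shuffle product sigma is a cycle of top degree and every cycle z
    is homologous to a multiple of it, which is zero outside that degree. The
    coefficient is read off at a list w0 of singletons: nothing splits there, so
    boundaries vanish at w0 and sigma is not a boundary. *)
Lemma bdry_list_homology E :
  exists sigma : seq {set X} -> R, exists w0,
  [/\ blocks E w0 /\ size w0 = #|E|,
      forall u, bdry_list u w0 = 0,
      sigma w0 = 1,
      forall w, blocks E w -> bdry_list sigma w = 0 &
      forall n z,
        (forall w, blocks E w -> (size w).+1 = n -> bdry_list z w = 0) ->
        exists u, forall w, blocks E w -> size w = n ->
          z w = (n == #|E|)%:R * z w0 * sigma w + bdry_list u w].
Proof.
have [m] := ubnP #|E|; elim: m E => // m IHm E; rewrite ltnS => Em.
have [E0|/set0Pn[x xE]] := eqVneq E set0.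
  have blocks0 w : blocks E w -> w = [::].
    case: w => // a w /= /and3P[/negPf a0]; rewrite E0 subset0 => aE.
    by rewrite aE in a0.
  exists (fun=> 1), [::]; split=> //=; first by rewrite E0 eqxx cards0.
    by move=> w /blocks0->.
  move=> n z _; exists (fun=> 0) => w /blocks0-> /= <-.
  by rewrite E0 cards0 !mulr1 mul1r addr0.
have cE : #|E| = #|E :\ x|.+1 by rewrite (cardsD1 x E) xE.
have [|s' [w0 [[w0E sw0] Dw0 s'w0 Ds' exact']]] := IHm (E :\ x).
  by rewrite -cE.
have x1 : [set x] != set0 by rewrite -card_gt0 cards1.
have blocks_x v : blocks (E :\ x) v -> blocks E ([set x] :: v).
  by rewrite /= x1 sub1set xE.
have bdry_x z v : bdry_list z ([set x] :: v) = - bdry_list (fun u => z ([set x] :: u)) v.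
  rewrite /= big_pred0 => [|b]; last exact: proper_part_set1.
  by rewrite oppr0 sub0r.
exists (shuffle x s'), ([set x] :: w0); split.
- by split; [exact: blocks_x | rewrite /= sw0].
- by move=> u; rewrite bdry_x Dw0 oppr0.
- by rewrite /= eqxx.
- move=> w wE; rewrite (bdry_shuffle _ xE wE) (shuffle0 xE wE) ?oppr0 //.
  by move=> v vE _; apply: Ds'.
case=> [|n] z zc.
  (* The only list without blocks is not a partition of E. *)
  by exists z => -[|//] /= /eqP E0; rewrite E0 inE in xE.
have [|u uP] := exact' n (fun v => z ([set x] :: v)).
  move=> v vE sv; apply: oppr_inj; rewrite -bdry_x oppr0; apply: zc.
    exact: blocks_x.
  by rewrite /= sv.
exists (fun v => homotopy x z v - shuffle x u v) => w wE sw.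
rewrite (linear_opB _ _ _ bdry_list_linear) (bdry_shuffle _ xE wE) opprK.
have := homotopy_identity z xE wE; rewrite [X in _ + X](homotopy0 xE wE); last first.
  by move=> v vE sv; apply: zc => //; rewrite sv.
rewrite addr0 => ->; rewrite cE eqSS.
have -> : shuffle x (fun v => z ([set x] :: v)) w =
   (n == #|E :\ x|)%:R * z ([set x] :: w0) * shuffle x s' w +
   shuffle x (bdry_list u) w.
  rewrite -(shuffle_linear x).2; apply: (eq_shuffle xE wE) => v vE sv.
  by apply: uP => //; apply: succn_inj; rewrite sv.
ring.
Qed.

End Lists.

(** * The top exterior power *)

Section Lines.
Variable k : fieldType.

Definition is_line (V : vectType k) : Prop :=
  exists f : {linear V -> k^o},
    (forall x, f x = 0 -> x = 0) /\ exists e, f e = 1.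

Lemma linear_pack (V W : lmodType k) (h : V -> W) :
  linear h -> exists h' : {linear V -> W}, h' =1 h.
Proof.
move=> hl; pose hm := GRing.isLinear.Build k V W *:%R h hl.
pose h' : {linear V -> W} := HB.pack h hm.
by exists h'.
Qed.

(** A line comes with a coordinate f and a vector e of coordinate 1; the
    isomorphism matches the coordinates. *)
Lemma line_iso (V W : vectType k) : is_line V -> is_line W -> vect_iso V W.
Proof.
move=> [f [f0 [a fa]]] [g [g0 [b gb]]].
have [h hE] : exists h : {linear V -> W}, h =1 (fun x => (f x : k) *: b).
  by apply: linear_pack => c x y; rewrite linearP /= scalerDl scalerA.
exists h; exists (fun y => (g y : k) *: a) => [x|y].
  apply/eqP; rewrite -subr_eq0; apply/eqP/f0.
  by rewrite linearB hE !linearZ /= fa gb; rewrite /GRing.scale /= !mulr1 subrr.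
apply/eqP; rewrite -subr_eq0; apply/eqP/g0.
by rewrite linearB hE !linearZ /= fa gb; rewrite /GRing.scale /= !mulr1 subrr.
Qed.

(** Permutations are products of transpositions, and each of these multiplies the
    wedge product by -1; all that counts below is that one scalar exists. *)
Lemma wedge_perm (T : finType) n (v : {ffun 'I_n -> freev k T}) (s : 'S_n) :
  exists c : k, wedge [ffun l => v (s l)] = c *: wedge v.
Proof.
have [ts -> tsD] := prod_tpermP s; elim: ts tsD => [|[i j] ts IHts] /=.
  exists 1; rewrite scale1r big_nil; congr wedge.
  by apply/ffunP => l; rewrite ffunE perm1.
case/andP=> /= ij /IHts[c cE]; exists (- c).
set s' := (\prod_(_ <- _) _)%g in cE *.
have := alternating_swap (@wedge_multilinear k T n) (@wedge_alternating k T n)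
  [ffun l => v (s' l)] ij.
rewrite cE big_cons -/s' => /eqP; rewrite addrC addr_eq0 scaleNr => /eqP<-.
by congr wedge; apply/ffunP => l; rewrite !ffunE permM.
Qed.

(** All wedge products of basis words are multiples of the one that lists T in
    order, and the determinant takes the value 1 on that one. *)
Lemma exterior_line (T : finType) n : #|T| = n -> is_line (exterior_power k T n).
Proof.
move=> cT; subst n.
pose M (v : {ffun 'I_#|T| -> freev k T}) : 'M[k]_#|T| :=
  \matrix_(i, j) (v i (enum_val j) : k).
pose d v : k^o := \det (M v).
have dm : multilinear d.
  move=> v i a x y; rewrite /d.
  have rowE z : row' i (M (replace v i z)) = row' i (M v).
    by apply/matrixP => p q; rewrite !mxE !ffunE eq_sym (negPf (neq_lift _ _)).
  rewrite [RHS](_ : _ = a * \det (M (replace v i x)) + 1 * \det (M (replace v i y)));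
    last by rewrite mul1r.
  apply: (determinant_multilinear (i0 := i)); rewrite ?rowE //.
  by apply/rowP => q; rewrite !mxE !ffunE eqxx mul1r !ffunE.
have da : alternating d.
  move=> v i j ij vij; apply: (determinant_alternate ij) => q.
  by rewrite !mxE vij.
have [g [gw _]] := exterior_power_universal dm da.
pose w0 : {ffun 'I_#|T| -> T} := [ffun i => enum_val i].
pose e : exterior_power k T #|T| := wedge (basis_word k w0).
have ge : g e = 1.
  rewrite gw /d (_ : M _ = 1%:M) ?det1 //; apply/matrixP => i j.
  by rewrite !mxE !ffunE (inj_eq enum_val_inj) eq_sym.
have word_e w : exists c : k, wedge (basis_word k w) = c *: e.
  have [/injectiveP w_inj|/injectivePn[i [j ij wij]]] := boolP (injectiveb w).
    have s_inj : injective (fun i => enum_rank (w i)).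
      by move=> i j /enum_rank_inj/w_inj.
    have [c cE] := wedge_perm (basis_word k w0) (perm s_inj).
    exists c; rewrite -cE; congr wedge; apply/ffunP => l.
    by rewrite !ffunE permE enum_rankK.
  exists 0; rewrite scale0r; apply: (wedge_alternating ij).
  by rewrite !ffunE wij.
have all_e q : exists c : k, q = c *: e.
  have [x _ <-] := subquot_proj_surj q; rewrite (freev_sum x).
  have [h hE] := linear_pack (@subquot_proj_linear k _ fullv (alt_relations k T #|T|)).
  rewrite -hE linear_sum /=.
  elim: (index_enum _) => [|w r [c cE]].
    by exists 0; rewrite big_nil scale0r.
  have [c' c'E] := word_e w; exists ((x w : k) * c' + c).
  rewrite big_cons cE linearZ /= hE scalerDl -scalerA -c'E.
  by rewrite /wedge pure_tensor_basis.
exists g; split; last by exists e.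
move=> q; have [c ->] := all_e q; rewrite linearZ /= ge => c0.
by rewrite -[c]mulr1 [c * 1]c0 scale0r.
Qed.

End Lines.

(** * Ordered partitions as lists of blocks *)

Section Words.
Variables (X : finType).
Implicit Types (E : {set X}).

Lemma codom_ffunS (T : Type) n (c : {ffun 'I_n.+1 -> T}) :
  codom c = c ord0 :: codom [ffun i => c (lift ord0 i)].
Proof.
rewrite /codom /image_mem enum_ordSl /= -map_comp; congr (_ :: _).
by apply: eq_map => i; rewrite /= ffunE.
Qed.

Lemma nth_codom_ord n (c : {ffun 'I_n -> {set X}}) (i : 'I_n) :
  nth set0 (codom c) i = c i.
Proof. by rewrite (nth_map i) ?size_enum_ord // nth_ord_enum. Qed.

Lemma size_codom_ord (T : Type) n (c : {ffun 'I_n -> T}) : size (codom c) = n.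
Proof. by rewrite size_codom card_ord. Qed.

Lemma codom_inj n : injective (fun c : {ffun 'I_n -> {set X}} => codom c).
Proof. by move=> c c' eqc; apply/ffunP => i; rewrite -!nth_codom_ord eqc. Qed.

Lemma codom_nth n (w : seq {set X}) :
  size w = n -> codom [ffun i : 'I_n => nth set0 w i] = w.
Proof.
move=> sw; apply: (@eq_from_nth _ set0); rewrite size_codom_ord // => i lt_i.
by rewrite (nth_codom_ord _ (Ordinal lt_i)) ffunE.
Qed.

Lemma ordered_partition_blocks n E (c : {ffun 'I_n -> {set X}}) :
  ordered_partition E c = blocks E (codom c).
Proof.
elim: n E c => [|n IHn] E c.
  rewrite /ordered_partition big_ord0 /codom /image_mem enum_ord0 /= eq_sym.
  by apply/and3P/idP => [[]//|->]; split=> //; apply/forallP=> -[].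
rewrite codom_ffunS /= -IHn; set c' := [ffun i => _].
have c'E i : c' i = c (lift ord0 i) by rewrite ffunE.
apply/and3P/and3P => -[].
  move=> /forallP ne /forallP dj /eqP cov.
  split; first exact: ne.
    by rewrite -cov; apply: bigcup_sup.
  apply/and3P; split.
  - by apply/forallP => i; rewrite c'E ne.
  - apply/forallP => i; apply/forallP => j; apply/implyP => ij.
    by rewrite !c'E (implyP (forallP (dj _) _)) // (inj_eq lift_inj).
  rewrite -cov big_ord_recl setDUl setDv set0U; apply/eqP.
  rewrite (eq_bigr _ (fun i _ => c'E i)).
  apply/esym/setDidPl; rewrite disjoint_sym bigcup_disjoint // => i _.
  by rewrite (implyP (forallP (dj _) _)).
move=> c0 c0E /and3P[/forallP ne /forallP dj /eqP cov].
have dj0 i : [disjoint c ord0 & c (lift ord0 i)].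
  rewrite -c'E disjoint_sym; have : c' i \subset E :\: c ord0.
    by rewrite -cov; apply: bigcup_sup.
  by rewrite subsetD => /andP[].
split.
- by apply/forallP => i; case: (unliftP ord0 i) => [j|] -> //; rewrite -c'E.
- apply/forallP => i; apply/forallP => j; apply/implyP.
  case: (unliftP ord0 i) => [i'|] ->; case: (unliftP ord0 j) => [j'|] ->.
  + by rewrite (inj_eq lift_inj) -!c'E => ij; rewrite (implyP (forallP (dj _) _)).
  + by rewrite disjoint_sym dj0.
  + by rewrite dj0.
  by rewrite eqxx.
rewrite big_ord_recl -(eq_bigr _ (fun i _ => c'E i)) cov.
by rewrite setDE setUIr setUCr setIT; apply/eqP/setUidPr.
Qed.

Definition merge_list i (v : seq {set X}) :=
  take i v ++ (nth set0 v i :|: nth set0 v i.+1) :: drop i.+2 v.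

Lemma codom_merge n (i : 'I_n) (c : {ffun 'I_n.+1 -> {set X}}) :
  codom (Defs.merge i c) = merge_list i (codom c).
Proof.
have ci := ltn_ord i.
have sz := size_codom_ord c.
apply: (@eq_from_nth _ set0).
  rewrite size_codom_ord size_cat /= size_drop size_takel sz; lia.
rewrite size_codom_ord => j lt_j.
rewrite (nth_codom_ord _ (Ordinal lt_j)) ffunE /= nth_cat size_takel ?sz; last by lia.
rewrite -!nth_codom_ord /= /bump add1n -val_eqE /=.
case: ltnP => ji; first by rewrite nth_take.
case: eqVneq => [->|neq]; first by rewrite subnn.
have -> : (j - i = (j - i.+1).+1)%N by lia.
by rewrite /= nth_drop; congr nth; lia.
Qed.

(** Splitting is the transpose of merging: v is a splitting of w exactly when
    merging the two parts gives back w. Disjointness and non-emptiness of the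
    blocks make the first part determine the second. *)
Lemma bdry_list_delta (R : comNzRingType) E v w : blocks E v ->
  bdry_list (fun u => (v == u)%:R : R) w =
  \sum_(i < (size v).-1) (-1) ^+ i.+1 * (merge_list i v == w)%:R.
Proof.
have D_0 := linear_op0 _ (bdry_list_linear R X).
have D_Z (c : R) (f : seq {set X} -> R) u : bdry_list (fun v => c * f v) u = c * bdry_list f u.
  have := (bdry_list_linear R X).2 c f (fun=> 0) u; rewrite D_0 addr0 => <-.
  by apply: (bdry_list_linear R X).1 => v'; rewrite addr0.
elim: v E w => [|a v IHv] E w.
  move=> _; rewrite big_ord0; case: w => //= e w.
  rewrite big1 // (D_0 w : bdry_list _ _ = 0) ?oppr0 ?addr0 //.
case/and3P=> a0 aE vE; case: w => [|e w].
  by rewrite big1 // => i _; rewrite /merge_list; case: (take _ _) => [|? ?]; apply: mulr0.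
rewrite [LHS]/=.
have -> : bdry_list (fun u => (a :: v == e :: u)%:R) w =
   (a == e)%:R * bdry_list (fun u => (v == u)%:R : R) w.
  rewrite -D_Z; apply: (bdry_list_linear R X).1 => u.
  by rewrite eqseq_cons -natrM mulnb.
rewrite (IHv _ w vE); case: v IHv vE => [|b v] _ vE.
  rewrite !big_ord0 big1 ?mulr0 ?oppr0 ?addr0 // => b _.
  by rewrite eqseq_cons andbF.
rewrite /= big_ord_recl expr1 mulN1r; congr (_ + _); last first.
  rewrite mulr_sumr -sumrN; apply: eq_bigr => i _.
  have -> : merge_list (lift ord0 i) [:: a, b & v] = a :: merge_list i (b :: v).
    by [].
  rewrite eqseq_cons -mulnb natrM mulrCA lift0 [(-1) ^+ i.+2]exprS mulN1r.
  by rewrite mulNr.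
congr (- _); rewrite /merge_list /= drop0 eqseq_cons.
case/and3P: vE => b0 bEa _; move: bEa; rewrite subsetD => /andP[bE ba].
have [<-|abe] := eqVneq (a :|: b) e; last first.
  rewrite big1 // => c /andP[_ /proper_sub ce]; rewrite eqseq_cons.
  case: eqVneq => //= ac; rewrite eqseq_cons; case: eqVneq => //= bec.
  by case/eqP: abe; rewrite bec ac -[X in X :|: _](setIidPr ce) setID.
have ea : (a :|: b) :\: a = b.
  rewrite setDUl setDv set0U; exact/setDidPl.
have pa : proper_part (a :|: b) a.
  rewrite /proper_part a0 properEneq subsetUl andbT; apply: contraNneq b0 => abE.
  by rewrite -ea -abE setDv.
rewrite (bigD1 a) //= ea !eqseq_cons !eqxx big1 ?addr0 // => c /andP[_ ca].
by rewrite eqseq_cons eq_sym (negPf ca).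
Qed.

End Words.

(** * The homology of the bar complex *)

Section Homology.
Variables (k : fieldType) (I : finType) (s t : itree I).
Variables (E : {set internal_edge t}) (sE : is_contraction s E).

Local Notation X := (internal_edge t).
Local Notation chains := (bar_chain k s t).

Definition word n (c : bar_basis s t n) : seq {set X} := codom (val c).

(** Extension by zero to all lists. *)
Definition chain_fun n (x : chains n) (w : seq {set X}) : k :=
  \sum_c (x c : k) * (word c == w)%:R.

Lemma word_inj n : injective (@word n).
Proof. by move=> c c' /codom_inj/val_inj. Qed.

Lemma blocks_word n (c : bar_basis s t n) : blocks E (word c).
Proof.
rewrite -ordered_partition_blocks; have /existsP[F /andP[sF cF]] := valP c.
by rewrite (contraction_unique sE sF).
Qed.

Lemma exists_word n w :
  blocks E w -> size w = n -> exists c : bar_basis s t n, word c = w.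
Proof.
move=> wE sw; have cP : bar_cond s [ffun i : 'I_n => nth set0 w i].
  by apply/existsP; exists E; rewrite sE ordered_partition_blocks codom_nth.
by exists (Sub _ cP); rewrite /word SubK codom_nth.
Qed.

Lemma chain_fun_word n (x : chains n) c : chain_fun x (word c) = x c.
Proof.
rewrite /chain_fun (bigD1 c) //= eqxx mulr1 big1 ?addr0 // => c' c'c.
by rewrite (inj_eq (@word_inj n)) (negPf c'c) mulr0.
Qed.

Lemma chain_fun_finfun n (f : seq {set X} -> k) w : blocks E w -> size w = n ->
  chain_fun ([ffun c => f (word c) : k^o] : chains n) w = f w.
Proof.
by move=> wE sw; have [c <-] := exists_word wE sw; rewrite chain_fun_word ffunE.
Qed.

Lemma bar_bdry_word n (x : chains n.+1) (c : bar_basis s t n) :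
  bar_bdry k s t n x c = bdry_list (chain_fun x) (word c).
Proof.
have Dl := bdry_list_linear k X.
rewrite /chain_fun (linear_op_sum _ _ _ _ Dl) lfunE /= /free_ext sum_ffunE.
apply: eq_bigr => c' _.
have -> : bdry_list (fun v => (x c' : k) * (word c' == v)%:R) (word c) =
    (x c' : k) * bdry_list (fun v => (word c' == v)%:R) (word c).
  have := Dl.2 (x c') (fun v => (word c' == v)%:R) (fun=> 0) (word c).
  rewrite (linear_op0 _ Dl) addr0 => <-.
  by apply: Dl.1 => v; rewrite addr0.
rewrite (bdry_list_delta _ _ (blocks_word c')) ffunE /GRing.scale /=; congr (_ * _).
rewrite /bar_bdry_basis sum_ffunE size_codom_ord; apply: eq_bigr => i _.
rewrite !ffunE /GRing.scale /= -codom_merge; congr (_ * _%:R).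
by rewrite eq_sym -(inj_eq (@word_inj n)).
Qed.

Lemma bar_cycle n (x : chains n) : x \in cycles (bar_complex k s t) n ->
  forall w, blocks E w -> (size w).+1 = n -> bdry_list (chain_fun x) w = 0.
Proof.
case: n x => // n x; rewrite memv_ker => /eqP dx w wE [sw].
have [c <-] := exists_word wE sw; rewrite -bar_bdry_word.
by move: dx => /= ->; rewrite ffunE.
Qed.

Lemma bar_cycleP n (x : chains n) :
  (forall w, blocks E w -> (size w).+1 = n -> bdry_list (chain_fun x) w = 0) ->
  x \in cycles (bar_complex k s t) n.
Proof.
case: n x => [|n] x dx; first exact: memvf.
rewrite memv_ker; apply/eqP/ffunP => c; rewrite [LHS]bar_bdry_word ffunE.
by apply: dx; [exact: blocks_word | rewrite size_codom_ord].
Qed.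

(** The coordinate on the top homology is the coefficient at w0, which vanishes on
    boundaries. *)
Lemma bar_homology :
  (forall n, n <> #|E| -> vect_zero (homology (bar_complex k s t) n)) /\
  is_line (homology (bar_complex k s t) #|E|).
Proof.
have [sg [w0 [[w0E sw0] Dw0 sw1 Dsg exactP]]] := bdry_list_homology k E.
pose C := bar_complex k s t.
pose sgc n : chains n := [ffun c => sg (word c) : k^o].
(* A cycle is a multiple of sg up to a boundary, the multiple being zero
     outside the top degree. *)
have decomp n (x : chains n) : x \in cycles C n ->
    exists y : chains n.+1,
      x = ((n == #|E|)%:R * chain_fun x w0) *: sgc n + bdry C n y.
  move=> /bar_cycle/exactP[u uP].
  exists [ffun c => u (word c) : k^o]; apply/ffunP => c.
  have cE := blocks_word c; have sc : size (word c) = n := size_codom_ord _.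
  rewrite ffunE [X in _ = _ + X]bar_bdry_word -(chain_fun_word x) (uP _ cE sc).
  congr (_ + _); first by rewrite !ffunE.
  apply: (eq_bdry_list cE) => v vE sv; rewrite chain_fun_finfun //.
  by rewrite sv sc.
have sub_cycles n (q : homology C n) : vsval q \in cycles C n.
  exact: (subvP (diffvSl _ _) _ (subvsP q)).
have bdry_eq0 n (q : homology C n) : vsval q \in limg (bdry C n) -> q = 0.
  move=> qB; apply: val_inj => /=; apply/eqP.
  by rewrite -memv0 -(capv_diff (cycles C n) (limg (bdry C n))) memv_cap subvsP.
split=> [n /eqP/negPf nE q|].
  apply: bdry_eq0; have [y ->] := decomp n _ (sub_cycles _ q).
  by rewrite nE mul0r scale0r add0r memv_img ?memvf.
have bdry_w0 x : x \in limg (bdry C #|E|) -> chain_fun (x : chains #|E|) w0 = 0.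
  case/memv_imgP=> y _ ->; have [c cw] := exists_word w0E sw0.
  by rewrite -cw chain_fun_word bar_bdry_word cw Dw0.
have [f fE] : exists f : {linear homology C #|E| -> k^o},
    f =1 fun q => chain_fun (vsval q : chains #|E|) w0.
  apply: linear_pack => a x y; have [c <-] := exists_word w0E sw0.
  by rewrite !chain_fun_word linearP /= !ffunE.
exists f; split=> [q|].
  rewrite fE => q0; apply: bdry_eq0; have [y ->] := decomp _ _ (sub_cycles _ q).
  by rewrite q0 mulr0 scale0r add0r memv_img ?memvf.
exists (subquot_proj (cycles C #|E|) (limg (bdry C #|E|)) (sgc #|E|)).
have sgU : sgc #|E| \in cycles C #|E|.
  apply: bar_cycleP => w wE sw; rewrite -[RHS](Dsg w wE).
  by apply: (eq_bdry_list wE) => v vE sv; rewrite chain_fun_finfun // sv.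
have sgUW := subvP (addvSl _ (limg (bdry C #|E|))) _ sgU.
have [c cw] := exists_word w0E sw0.
have sgw : chain_fun (sgc #|E|) w0 = 1 by rewrite chain_fun_finfun.
rewrite fE -sgw -[in RHS](addv_pi1_pi2 sgUW) -cw !chain_fun_word ffunE.
by rewrite -[X in _ = _ + X]chain_fun_word cw bdry_w0 ?addr0 // memv_pi2.
Qed.

Lemma koszul_top :
  koszul_complex k s t #|E| = exterior_power k {x : X | x \in E} #|E|.
Proof.
rewrite /koszul_complex; case: pickP => [F sF|/(_ E)]; last by rewrite sE.
by rewrite -(contraction_unique sE sF) eqxx.
Qed.

End Homology.

Theorem theorem1p4p3 (k : fieldType) (I : finType) (hI : (1 < #|I|)%N)
    (s t : itree I) :
  (forall (E : {set internal_edge t}) (n : nat),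
     is_contraction s E -> #|E| = n ->
     [/\ vect_iso (homology (bar_complex k s t) n) (koszul_complex k s t n),
         koszul_complex k s t n =
           exterior_power k {x : internal_edge t | x \in E} n &
         forall i : nat, i <> n -> vect_zero (homology (bar_complex k s t) i)])
  /\
  ((~ exists E : {set internal_edge t}, is_contraction s E) ->
   forall i : nat, vect_zero (chain (bar_complex k s t) i) /\
                   vect_zero (koszul_complex k s t i)).
Proof.
split=> [E _ sE <-|noE i].
  have [H0 Hline] := bar_homology k sE; split=> //; last exact: koszul_top.
  rewrite (koszul_top k sE); apply: line_iso Hline _.
  by apply: exterior_line; rewrite card_sig; apply: eq_card => x.
split=> x.
  apply/ffunP => c; have /existsP[E /andP[sE _]] := valP c.
  by case: noE; exists E.
move: x; rewrite /koszul_complex; case: pickP => [E sE|_ x].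
  by case: noE; exists E.
by apply/rowP => -[].
Qed.
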